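(* Let $\lambda\in\Lambda[a,b]$ and $1\le p<2$, let $f$ be a $(\lambda,p)$-decomposable function on $[a,b]$, and let $F\in\mathrm{dual}(\mathcal W_p)[a,b]$. (a) If $(LC)\int F\,d_\lambda g$ is defined on $[a,b]$ for some $(g,h)\in D^+_{\lambda,p}(f)$, then the Left $\lambda$-integral $(L)\int F\,d_\lambda f$ is defined on $[a,b]$ with respect to $D^+_{\lambda,p}(f)$. (b) If $(RC)\int F\,d_\lambda g$ is defined on $[a,b]$ for some $(g,h)\in D^-_{\lambda,p}(f)$, then the Right $\lambda$-integral $(R)\int F\,d_\lambda f$ is defined on $[a,b]$ with respect to $D^-_{\lambda,p}(f)$.
   Context: Fix real $a<b$. A function $f:[a,b]\to\mathbb R$ is regulated if the finite limits $f(t-)$, $t\in(a,b]$, and $f(s+)$, $s\in[a,b)$, exist; $\Delta^-f(t)=f(t)-f(t-)$ and $\Delta^+f(s)=f(s+)-f(s)$. $\Lambda[a,b]$ is the set of sequences $\lambda=\{\lambda_m:m\ge1\}$ of partitions (finite sets $a=t_0<\dots<t_n=b$) of $[a,b]$ with $\lambda_m\subset\lambda_{m+1}$ and $\cup\lambda:=\bigcup_m\lambda_m$ dense in $[a,b]$. For $a\le s<t\le b$ let $\lambda_m|_{[s,t]}=\{s,t\}\cup(\lambda_m\cap(s,t))=\{s=x_0<\dots<x_n=t\}$. Sums over the points of an interval are unconditional (equivalently, absolutely convergent). A regulated $f$ has the quadratic $\lambda$-variation on $[a,b]$, written $f\in Q_\lambda[a,b]$, if there is a regulated $V$ with $V(a)=0$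 and, for all $a\le s<t\le b$, $V(t)-V(s)=\lim_{m\to\infty}\sum_i[f(x_i)-f(x_{i-1})]^2$ (sum over $\lambda_m|_{[s,t]}$), $\Delta^-V(t)=(\Delta^-f(t))^2$, $\Delta^+V(s)=(\Delta^+f(s))^2$. For $0<p<\infty$, $v_p(f;[a,b])=\sup\sum_i|f(t_i)-f(t_{i-1})|^p$ over all partitions of $[a,b]$, and $\mathcal W_p[a,b]=\{f:v_p(f;[a,b])<\infty\}$. $\mathrm{dual}(\mathcal W_1)[a,b]$ is the set of all regulated functions on $[a,b]$; for $1<p<\infty$, $\mathrm{dual}(\mathcal W_p)[a,b]=\bigcup\{\mathcal W_q[a,b]:\tfrac1p+\tfrac1q>1\}$. A regulated $f$ is $(\lambda,p)$-decomposable if there is a pair $(g,h)$ of regulated functions with $g\in Q_\lambda[a,b]\cap\mathrm{dual}(\mathcal W_p)[a,b]$, $h\in\mathcal W_p[a,b]$, $g(a)=h(a)=0$ and $f\equiv C+g+h$ for some constant $C$; $D_{\lambda,p}(f)$ is the set of all such pairs. $D^+_{\lambda,p}(f)$ is the set of $(g,h)\in D_{\lambda,p}(f)$ with $\{t\in(a,b):\Delta^+g(t)\ne0\}\cup\{t\in(a,b):\Delta^+h(t)\ne0\}\subset\cup\lambda$; $D^-_{\lambda,p}(f)$ is defined in the same way with $\Delta^-$ in place of $\Delta^+$. Cauchy $\lambda$-integrals: for regulated $F,g$, $(LC)\int F\,d_\lambda g$ is defined on $[a,b]$ if there is a regulated $\Phi$ with $\Phi(a)=0$ and, for all $a\le s<t\le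 b$, $\Phi(t)-\Phi(s)=\lim_m\sum_iF(x_{i-1})[g(x_i)-g(x_{i-1})]$ (sum over $\lambda_m|_{[s,t]}$), $\Delta^-\Phi(t)=F(t-)\Delta^-g(t)$, $\Delta^+\Phi(s)=F(s)\Delta^+g(s)$; then $(LC)\int_s^tF\,d_\lambda g=\Phi(t)-\Phi(s)$. $(RC)\int F\,d_\lambda g$ is defined on $[a,b]$ if there is a regulated $\Psi$ with $\Psi(a)=0$, $\Psi(t)-\Psi(s)=\lim_m\sum_iF(x_i)[g(x_i)-g(x_{i-1})]$, $\Delta^-\Psi(t)=F(t)\Delta^-g(t)$, $\Delta^+\Psi(s)=F(s+)\Delta^+g(s)$; then $(RC)\int_s^tF\,d_\lambda g=\Psi(t)-\Psi(s)$. Young integrals: $(RRS)\int$ is the refinement Riemann–Stieltjes integral (limit of Riemann–Stieltjes sums over tagged partitions directed by refinement). For regulated $F,h$ and $u<v$ let $F_-^{(u)}(x)=F(x-)$ for $x\in(u,v]$, $F_-^{(u)}(u)=F(u)$, and $F_+^{(v)}(x)=F(x+)$ for $x\in[u,v)$, $F_+^{(v)}(v)=F(v)$ (similarly for $h$). Then $(LY)\int_u^vF\,dh=(RRS)\int_u^vF_-^{(u)}\,dh_+^{(v)}+F(u)\Delta^+h(u)+\sum_{(u,v)}\Delta^-F\Delta^+h$ and $(RY)\int_u^vF\,dh=(RRS)\int_u^vF_+^{(v)}\,dh_-^{(u)}-\sum_{(u,v)}\Delta^+F\Delta^-h+F(v)\Delta^-h(v)$, provided the integral exists and the sum converges unconditionally;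 both are $0$ if $u=v$. For regulated $F$ and $A\subset D_{\lambda,p}(f)$, the Left $\lambda$-integral $(L)\int F\,d_\lambda f$ is defined on $[a,b]$ with respect to $A$ if for each $(g,h)\in A$ the sum $(LC)\int F\,d_\lambda g+(LY)\int F\,dh$ is defined on $[a,b]$ and, for all $a\le u\le v\le b$, the value $(LC)\int_u^vF\,d_\lambda g+(LY)\int_u^vF\,dh=:(L)\int_u^vF\,d_\lambda f$ does not depend on $(g,h)\in A$. The Right $\lambda$-integral $(R)\int F\,d_\lambda f$ with respect to $A$ is defined in the same way with $(RC)$ and $(RY)$ in place of $(LC)$ and $(LY)$. *)

(* Defs.v *)
(* Functions on [a, b] are represented by total functions
   [R -> R]; only their values on [a, b] are ever used. A partition
   a = t_0 < t_1 < ... < t_n = b is represented, as in [itv_partition], by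
   the sequence [:: t_1; ...; t_n]; its set of points is [a :: s]. *)
From HB Require Import structures.
From mathcomp Require Import all_boot all_order all_algebra finmap.
From mathcomp Require Import all_classical all_reals.
From mathcomp Require Import ereal topology normedtype sequences numfun realfun exp.
From mathcomp.analysis.showcase Require Import summability.

Set Implicit Arguments.
Unset Strict Implicit.
Unset Printing Implicit Defensive.

Import Order.TTheory GRing.Theory Num.Theory.
Import numFieldNormedType.Exports.
Local Open Scope classical_set_scope.
Local Open Scope ring_scope.

Section quadratic_lambda_variation.
Context {R : realType}.
Implicit Types (a b s t u v x p : R) (f g h F V Phi Psi : R -> R).
Implicit Types (lam : nat -> seq R) (gh : (R -> R) * (R -> R)).

Definition llim f t : R := lim (f x @[x --> t^'-]).
Definition rlim f s : R := lim (f x @[x --> s^'+]).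

Definition regulated a b f : Prop :=
  (forall t, a < t <= b -> cvg (f x @[x --> t^'-])) /\
  (forall s, a <= s < b -> cvg (f x @[x --> s^'+])).

Definition ljump f t : R := f t - llim f t.
Definition rjump f s : R := rlim f s - f s.

(* sum of phi x_{i-1} x_i over the partition u = x_0 < ... < x_n coded by k *)
Definition part_sum u (k : seq R) (phi : R -> R -> R) : R :=
  \sum_(0 <= i < size k) phi (nth 0 (u :: k) i) (nth 0 (u :: k) i.+1).

Definition lam_union a lam : set R := [set x | exists m, x \in a :: lam m].

(* The sequence is indexed from 0 instead of 1. *)
Definition Lambda a b lam : Prop :=
  [/\ forall m, itv_partition a b (lam m),
      forall m, {subset a :: lam m <= a :: lam m.+1} &
      [set x | a <= x <= b] `<=` closure (lam_union a lam)].

Definition lam_restr lam m s t : seq R :=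
  rcons [seq x <- lam m | s < x < t] t.

Definition lam_sum_cvg lam s t (phi : R -> R -> R) (l : R) : Prop :=
  part_sum s (lam_restr lam m s t) phi @[m --> \oo] --> l.

Definition quadratic_variation a b lam f : Prop :=
  exists V, [/\ regulated a b V, V a = 0,
    forall s t, a <= s -> s < t -> t <= b ->
      lam_sum_cvg lam s t (fun x y => (f y - f x) ^+ 2) (V t - V s),
    forall t, a < t <= b -> ljump V t = ljump f t ^+ 2 &
    forall s, a <= s < b -> rjump V s = rjump f s ^+ 2].

Definition pvariation p a b f : \bar R :=
  ereal_sup [set (part_sum a k (fun x y => `|f y - f x| `^ p))%:E
            | k in itv_partition a b].

Definition Wp p a b f : Prop := (pvariation p a b f < +oo)%E.

(* for 1 <= p *)
Definition dualW p a b f : Prop :=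
  (p = 1 /\ regulated a b f) \/
  (1 < p /\ exists q : R, [/\ 0 < q, p^-1 + q^-1 > 1 & Wp q a b f]).

Definition decomps a b lam p f : set ((R -> R) * (R -> R)) :=
  [set gh | [/\ regulated a b gh.1 /\ regulated a b gh.2,
    quadratic_variation a b lam gh.1 /\ dualW p a b gh.1,
    Wp p a b gh.2,
    gh.1 a = 0 /\ gh.2 a = 0 &
    exists C : R, forall x, a <= x <= b -> f x = C + gh.1 x + gh.2 x]].

Definition decomposable a b lam p f : Prop :=
  regulated a b f /\ decomps a b lam p f !=set0.

Definition decomps_plus a b lam p f : set ((R -> R) * (R -> R)) :=
  [set gh | decomps a b lam p f gh /\
    [set t | a < t < b /\ rjump gh.1 t != 0] `|`
    [set t | a < t < b /\ rjump gh.2 t != 0] `<=` lam_union a lam].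

Definition decomps_minus a b lam p f : set ((R -> R) * (R -> R)) :=
  [set gh | decomps a b lam p f gh /\
    [set t | a < t < b /\ ljump gh.1 t != 0] `|`
    [set t | a < t < b /\ ljump gh.2 t != 0] `<=` lam_union a lam].

Definition is_LC a b lam F g Phi : Prop :=
  [/\ regulated a b Phi, Phi a = 0,
    forall s t, a <= s -> s < t -> t <= b ->
      lam_sum_cvg lam s t (fun x y => F x * (g y - g x)) (Phi t - Phi s),
    forall t, a < t <= b -> ljump Phi t = llim F t * ljump g t &
    forall s, a <= s < b -> rjump Phi s = F s * rjump g s].

Definition is_RC a b lam F g Psi : Prop :=
  [/\ regulated a b Psi, Psi a = 0,
    forall s t, a <= s -> s < t -> t <= b ->
      lam_sum_cvg lam s t (fun x y => F y * (g y - g x)) (Psi t - Psi s),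
    forall t, a < t <= b -> ljump Psi t = F t * ljump g t &
    forall s, a <= s < b -> rjump Psi s = rlim F s * rjump g s].

Definition LC_defined a b lam F g : Prop := exists Phi, is_LC a b lam F g Phi.
Definition RC_defined a b lam F g : Prop := exists Psi, is_RC a b lam F g Psi.

Definition tags u (k y : seq R) : Prop :=
  size y = size k /\ forall i, (i < size k)%N ->
    nth 0 (u :: k) i <= nth 0 y i <= nth 0 (u :: k) i.+1.

Definition RS_sum u (k y : seq R) F h : R :=
  \sum_(0 <= i < size k)
    F (nth 0 y i) * (h (nth 0 (u :: k) i.+1) - h (nth 0 (u :: k) i)).

Definition is_RRS u v F h (I : R) : Prop :=
  forall e : R, 0 < e -> exists k0 : seq R, itv_partition u v k0 /\
    forall k y : seq R, itv_partition u v k -> {subset k0 <= k} ->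
      tags u k y -> `|RS_sum u k y F h - I| < e.

(* unconditional sum of phi over A: limit of the finite partial sums along
   the finite sets directed by inclusion *)
Definition is_usum (A : set R) (phi : R -> R) (S : R) : Prop :=
  partial_sum (patch (fun=> 0) A phi) @ totally --> S.

Definition left_mod u F x : R := if u < x then llim F x else F x.
Definition right_mod v F x : R := if x < v then rlim F x else F x.

(* for u <= v *)
Definition is_LY u v F h (I : R) : Prop :=
  (u = v /\ I = 0) \/
  (u < v /\ exists J S : R,
    [/\ is_RRS u v (left_mod u F) (right_mod v h) J,
        is_usum [set x | u < x < v] (fun x => ljump F x * rjump h x) S &
        I = J + F u * rjump h u + S]).

Definition is_RY u v F h (I : R) : Prop :=
  (u = v /\ I = 0) \/
  (u < v /\ exists J S : R,
    [/\ is_RRS u v (right_mod v F) (left_mod u h) J,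
        is_usum [set x | u < x < v] (fun x => rjump F x * ljump h x) S &
        I = J - S + F v * ljump h v]).

(* the Young integral is required over every subinterval of [a, b] *)
Definition LY_defined a b F h : Prop :=
  forall u v, a <= u -> u <= v -> v <= b -> exists I, is_LY u v F h I.
Definition RY_defined a b F h : Prop :=
  forall u v, a <= u -> u <= v -> v <= b -> exists I, is_RY u v F h I.

(* z is the value of (LC) int_u^v F dg + (LY) int_u^v F dh *)
Definition is_LCLY a b lam F gh u v (z : R) : Prop :=
  exists Phi I, [/\ is_LC a b lam F gh.1 Phi, is_LY u v F gh.2 I &
                    z = Phi v - Phi u + I].
Definition is_RCRY a b lam F gh u v (z : R) : Prop :=
  exists Psi I, [/\ is_RC a b lam F gh.1 Psi, is_RY u v F gh.2 I &
                    z = Psi v - Psi u + I].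

(* The Left (Right) lambda-integral of F with respect to f enters only through
   the set A of decompositions of f. *)
Definition Left_defined a b lam F (A : set ((R -> R) * (R -> R))) : Prop :=
  (forall gh, A gh -> LC_defined a b lam F gh.1 /\ LY_defined a b F gh.2) /\
  (forall u v, a <= u -> u <= v -> v <= b ->
    forall gh gh', A gh -> A gh' -> forall z z',
      is_LCLY a b lam F gh u v z -> is_LCLY a b lam F gh' u v z' -> z = z').

Definition Right_defined a b lam F (A : set ((R -> R) * (R -> R))) : Prop :=
  (forall gh, A gh -> RC_defined a b lam F gh.1 /\ RY_defined a b F gh.2) /\
  (forall u v, a <= u -> u <= v -> v <= b ->
    forall gh gh', A gh -> A gh' -> forall z z',
      is_RCRY a b lam F gh u v z -> is_RCRY a b lam F gh' u v z' -> z = z').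

End quadratic_lambda_variation.

(* Main.v *)
Require Import Defs.
From mathcomp Require Import all_boot all_order all_algebra finmap.
From mathcomp Require Import all_classical all_reals.
From mathcomp Require Import ereal topology normedtype sequences numfun realfun exp.
From mathcomp.analysis.showcase Require Import summability.
From mathcomp Require Import ring lra zify.

(** The left and the right integral are treated together: a boolean [d] selects
the side, [true] for the left one.

The core is [integrable_dualW]. Let [h] have finite p-variation, with its right
jumps (left jumps, on the right side) inside ]a, b[ located on the union of
lambda, and let [F] be in the dual class of W_p. Then one function Phi is at the
same time the indefinite Young integral of [F dh] and the limit, over every
subinterval, of the Cauchy sums of [F dh] along lambda, and its one-sided jumps
are those that a Cauchy lambda-integral must have. Two consequences give the
theorem. For a decomposition f = C + g + h the Cauchy sums against [g] and [h]
add up to those against [f], so the value LC + LY is the limit of the Cauchy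
sums of [F df], in which the decomposition no longer occurs
([lam_value_limit]). And if (g, h), (g', h') are two decompositions, then
g' = g + h - h', so an indefinite Cauchy integral against [g], corrected by the
functions Phi of [h] and [h'], is one against [g'] ([cauchy_transfer]).

The core is proved by approximation of the integrand, with [h] fixed.
- The conclusion is linear in [F] ([integrable_lin]).
- It holds for indicators of half lines, by computation ([integrable_thr]). The
  Cauchy sum of the indicator of [c, +oo[ over [u, v] is h(v) - h(x), where x is
  the first partition point not before c. When c is never a partition point
  this tends to h(v) - h(c+), while the Young integral is h(v) - h(c): here, and
  only here, the jumps of [h] have to lie on lambda.
- It is stable under approximations [F'] of [F] that are uniformly close and for
  which every Riemann-Stieltjes sum of [F - F'] against [h] is small
  ([integrable_closed]). Smallness is required for arbitrary monotone sequences
  of points and of tags, the tags not having to lie between the points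
  ([rs_bound]). In this form it survives monotone changes of variable and
  pointwise limits, hence passes to the one-sided modifications of [F] and [h]
  and to the sums of products of jumps that make up the Young integral.
- Such approximations exist ([dualW_approx]): take F' = F o phi for a
  nondecreasing step function phi with |F - F o phi| <= e ([step_approx]). If
  p = 1, the sums of F - F' are at most e times the variation of [h]. If p > 1,
  the q-variation of F - F' stays bounded because phi is monotone, so for any
  larger exponent the variation tends to 0 with e, and the Love-Young
  inequality ([young_sum]) bounds the sums. *)

Set Implicit Arguments.
Unset Strict Implicit.
Unset Printing Implicit Defensive.

Import Order.TTheory GRing.Theory Num.Theory.
Import numFieldNormedType.Exports.
Local Open Scope classical_set_scope.
Local Open Scope ring_scope.

(** * The Love-Young inequality on monotone samplings *)

Section young.
Context {R : realType}.
Implicit Types (a b x y : R) (F G h w W : R -> R) (X Y : nat -> R).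

(** Removing the point of index i0.+1 together with the tag of the same index merges
two neighbouring terms; the defect is a product of two increments. *)
Lemma sum_bump (g x : nat -> R) n i0 : (i0 <= n)%N ->
  \sum_(i < n.+2) g i * (x i.+1 - x i) =
  \sum_(i < n.+1) g (bump i0.+1 i) * (x (bump i0.+1 i.+1) - x (bump i0.+1 i))
    + (g i0.+1 - g i0) * (x i0.+2 - x i0.+1).
Proof.
elim: n => [|n IH] in i0 *.
  rewrite leqn0 => /eqP ->; rewrite !big_ord_recr !big_ord0 /= /bump /=; ring.
rewrite leq_eqVlt => /orP[/eqP -> |ltin]; last first.
  rewrite big_ord_recr (IH i0) //= [in RHS]big_ord_recr /=.
  have -> : bump i0.+1 n.+1 = n.+2 by rewrite /bump ltin.
  have -> : bump i0.+1 n.+2 = n.+3 by rewrite /bump ltnS ltnW.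
  by rewrite addrAC.
rewrite big_ord_recr big_ord_recr /= [in RHS]big_ord_recr /=.
have -> : bump n.+2 n.+1 = n.+1 by rewrite /bump ltnn.
have -> : bump n.+2 n.+2 = n.+3 by rewrite /bump leqnn.
under [in RHS]eq_bigr => i _.
  have -> : bump n.+2 i = i by rewrite /bump ltnNge (ltnW (ltn_ord i)).
  have -> : bump n.+2 i.+1 = i.+1 by rewrite /bump ltnNge (ltn_ord i).
  over.
ring.
Qed.

Lemma exists_le_avg (n : nat) (u : nat -> R) (c : R) :
  \sum_(i < n.+1) u i <= c -> exists2 i, (i <= n)%N & u i <= c / n.+1%:R.
Proof.
move=> uc; apply/not_exists2P => noti.
suff : c < \sum_(i < n.+1) u i by rewrite ltNge uc.
have -> : c = \sum_(i < n.+1) (c / n.+1%:R).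
  by rewrite sumr_const card_ord -[RHS]mulr_natr mulfVK // pnatr_eq0.
apply: ltr_sum => [|i _]; first by apply/hasP; exists ord0 => //; rewrite mem_index_enum.
by case: (noti i) => [/negP|/negP]; [rewrite -ltnS ltn_ord|rewrite -ltNge].
Qed.

(** Infinite sequences spare bounds on the indices; a finite sequence of points is
continued by its last point ([sampling_nth]). *)
Definition sampling a b X :=
  (forall i j, (i <= j)%N -> X i <= X j) /\ (forall i, a <= X i <= b).

Lemma sampling_bump a b X j : sampling a b X -> sampling a b (X \o bump j).
Proof.
move=> [Xm Xab]; split=> [i k ik|i]; last exact: Xab.
by apply: Xm; rewrite leq_bump2.
Qed.

Lemma sampling_ge a b X i j : sampling a b X -> (i <= j)%N ->
  [/\ a <= X i, X i <= X j & X j <= b].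
Proof.
by move=> [Xm Xab] ij; split; [case/andP: (Xab i)|exact: Xm|case/andP: (Xab j)].
Qed.

Lemma sampling_telescope a b X w (B : R) n :
  (forall x y, a <= x -> x <= y -> y <= b -> w x <= w y) -> w b - w a <= B ->
  sampling a b X -> \sum_(i < n) (w (X i.+1) - w (X i)) <= B.
Proof.
move=> wm wB Xs; rewrite -(big_mkord xpredT (fun i => w (X i.+1) - w (X i))).
rewrite telescope_sumr //; have [aX0 X0n Xnb] := sampling_ge Xs (leq0n n).
apply: le_trans wB; rewrite lerB // wm //; [exact: le_trans X0n|exact: le_trans Xnb].
Qed.

(** Young's argument: with n.+1 inner points, some index has both its [W]-increment
and its [w]-increment at most twice their averages, since the sum of the two
normalized increments is at most 2. Removing that point changes the sum by at
most [eta (2A/(n+1))^r (2B/(n+1))^s], and the errors made until no inner point is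
left form a partial sum of the Riemann series of exponent r + s. *)
Lemma young_sum a b G h w W (eta r s A B : R) :
  0 <= eta -> 0 < A -> 0 < B -> 0 < r -> 0 < s ->
  (forall x y, a <= x -> x <= y -> y <= b -> W x <= W y) ->
  (forall x y, a <= x -> x <= y -> y <= b -> w x <= w y) ->
  (forall x y, a <= x -> x <= y -> y <= b ->
    `|G y - G x| <= eta * (W y - W x) `^ r) ->
  (forall x y, a <= x -> x <= y -> y <= b -> `|h y - h x| <= (w y - w x) `^ s) ->
  W b - W a <= A -> w b - w a <= B ->
  forall n X Y, sampling a b X -> sampling a b Y ->
  `|\sum_(i < n.+1) G (Y i) * (h (X i.+1) - h (X i))
    - G (Y 0%N) * (h (X n.+1) - h (X 0%N))|
  <= \sum_(m < n) eta * ((2 * A) `^ r * (2 * B) `^ s) * riemannR (r + s) m.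
Proof.
move=> eta0 A0 B0 r0 s0 Wm wm GW hw WA wB; elim=> [|n IH] X Y Xs Ys.
  by rewrite big_ord_recr !big_ord0 /= add0r subrr normr0.
have Xs1 : sampling a b (X \o S).
  by split=> [i j ij|i]; [apply Xs; rewrite ltnS|apply Xs].
have [i0 i0n] : exists2 i, (i <= n)%N &
    (W (Y i.+1) - W (Y i)) / A + (w (X i.+2) - w (X i.+1)) / B <= 2 / n.+1%:R.
  apply: (@exists_le_avg n (fun i => (W (Y i.+1) - W (Y i)) / A
    + (w (X i.+2) - w (X i.+1)) / B)).
  rewrite big_split /= -!mulr_suml (_ : 2 = 1 + 1 :> R) //; apply: lerD.
    by rewrite ler_pdivrMr // mul1r; exact: sampling_telescope Ys.
  by rewrite ler_pdivrMr // mul1r; exact: sampling_telescope Xs1.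
move=> avg.
rewrite (sum_bump (G \o Y) (h \o X) i0n) /=.
have := IH _ _ (sampling_bump i0.+1 Xs) (sampling_bump i0.+1 Ys) => /=.
rewrite [bump i0.+1 0]/bump /= add0n.
have -> : bump i0.+1 n.+1 = n.+2 by rewrite /bump ltnS i0n.
set T := \sum_(i < n.+1) _; set T0 := G (Y 0%N) * _ => IH1.
rewrite big_ord_recr /= addrAC; apply: le_trans (ler_normD _ _) _; apply: lerD => //.
have [aY YY Yb] := sampling_ge Ys (leqnSn i0).
have [aX XX Xb] := sampling_ge Xs (leqnSn i0.+1).
have WY := Wm _ _ aY YY Yb; have wX := wm _ _ aX XX Xb.
have n0 : 0 < n.+1%:R :> R by rewrite ltr0n.
have WY' : W (Y i0.+1) - W (Y i0) <= 2 * A / n.+1%:R.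
  have : (W (Y i0.+1) - W (Y i0)) / A <= 2 / n.+1%:R.
    by apply: le_trans avg; rewrite lerDl divr_ge0 ?subr_ge0 // ltW.
  by rewrite ler_pdivrMr // mulrAC.
have wX' : w (X i0.+2) - w (X i0.+1) <= 2 * B / n.+1%:R.
  have : (w (X i0.+2) - w (X i0.+1)) / B <= 2 / n.+1%:R.
    by apply: le_trans avg; rewrite lerDr divr_ge0 ?subr_ge0 // ltW.
  by rewrite ler_pdivrMr // mulrAC.
rewrite normrM; apply: le_trans (ler_pM _ _ (GW _ _ aY YY Yb) (hw _ _ aX XX Xb)) _ => //.
rewrite -!mulrA ler_wpM2l //.
have A2 : 0 <= 2 * A by rewrite mulr_ge0 // ltW.
have B2 : 0 <= 2 * B by rewrite mulr_ge0 // ltW.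
have ni : 0 <= n.+1%:R^-1 :> R by rewrite invr_ge0 ler0n.
have A2n := mulr_ge0 A2 ni; have B2n := mulr_ge0 B2 ni.
have W2 : (W (Y i0.+1) - W (Y i0)) `^ r <= (2 * A) `^ r * (n.+1%:R^-1) `^ r.
  by rewrite -powRM //; apply: ge0_ler_powR; rewrite ?nnegrE ?subr_ge0 // ltW.
have w2 : (w (X i0.+2) - w (X i0.+1)) `^ s <= (2 * B) `^ s * (n.+1%:R^-1) `^ s.
  by rewrite -powRM //; apply: ge0_ler_powR; rewrite ?nnegrE ?subr_ge0 // ltW.
apply: le_trans (ler_pM _ _ W2 w2) _; rewrite ?powR_ge0 //.
rewrite /riemannR mulrACA -mulrA ler_wpM2l ?powR_ge0 // ler_wpM2l ?powR_ge0 //.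
rewrite -powRD; last by rewrite invr_eq0 pnatr_eq0 implybT.
by rewrite -powR_inv1 ?ler0n // -!powRrM mulN1r powRN.
Qed.

(** Cauchy condensation: the terms of index between 2^k and 2^(k+1) contribute at most
2^(k(1 - th)), which is summable. *)
Lemma riemannR_bounded (th : R) : 1 < th ->
  exists2 K, 0 <= K & forall n, \sum_(m < n) riemannR th m <= K.
Proof.
move=> th1; set c : R := 2 `^ (1 - th).
have c0 : 0 <= c by exact: powR_ge0.
have c1 : c < 1.
  rewrite lt_neqAle powR_eq1 pnatr_eq1 ltrn0 subr_eq0 (lt_eqF th1) /=.
  by rewrite -(powRr0 2) ler_powR ?ler1n // subr_le0 ltW.
have dy k : \sum_(m < (2 ^ k).-1) riemannR th m <= \sum_(j < k) c ^+ j.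
  elim: k => [|k IH]; first by rewrite !big_ord0.
  rewrite big_ord_recr /=.
  have -> : (2 ^ k.+1).-1 = ((2 ^ k).-1 + 2 ^ k)%N.
    by rewrite expnS mul2n -addnn; have := expn_gt0 2 k; case: (2 ^ k)%N.
  rewrite big_split_ord /= lerD //.
  have -> : c ^+ k = \sum_(i < 2 ^ k) (((2 ^ k)%N%:R : R) `^ th)^-1.
    rewrite sumr_const card_ord -[RHS]mulr_natr /c -powR_mulrn ?powR_ge0 //.
    rewrite -powRrM natrX -powR_mulrn // -powRrM mulrBl mul1r powRD; last by rewrite pnatr_eq0 implybT.
    by rewrite mulrC powRN (mulrC th).
  apply: ler_sum => i _; rewrite lef_pV2 ?posrE ?powR_gt0 ?ltr0n ?expn_gt0 //.
  apply: ge0_ler_powR; rewrite ?nnegrE ?ler0n //; first by rewrite ltW // (lt_trans _ th1).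
  by rewrite ler_nat; have := expn_gt0 2 k; lia.
exists (1 - c)^-1 => [|n]; first by rewrite invr_ge0 subr_ge0 ltW.
apply: (@le_trans _ _ (\sum_(m < (2 ^ n).-1) riemannR th m)).
  have le2 : (n <= (2 ^ n).-1)%N by have := ltn_expl n (isT : (1 < 2)%N); lia.
  rewrite -(subnKC le2) big_split_ord /= lerDl sumr_ge0 // => i _.
  by rewrite invr_ge0 powR_ge0.
apply: le_trans (dy n) _.
have c1' : 0 < 1 - c by rewrite subr_gt0.
rewrite -(ler_pM2l c1') mulfV ?gt_eqF // -opprB mulNr -subrX1.
by rewrite opprB gerBl exprn_ge0.
Qed.

End young.

(** * Functions of finite p-variation and their step approximations *)

Section variation.
Context {R : realType}.
Implicit Types (a b c x y t u v e al : R) (F G h w W : R -> R) (X Y : nat -> R).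

Lemma near_leftP (P : R -> Prop) t :
  (\forall x \near t^'-, P x) <->
  exists2 c, c < t & forall x, c < x -> x < t -> P x.
Proof.
split=> [|[c ct cP]]; last by near=> x; apply: cP.
move=> /nbhs_ballP[e /= e0 eP]; exists (t - e) => [|x tx xt].
  by rewrite ltrBlDr ltrDl.
by apply: eP => //; rewrite /ball /= gtr0_norm ?subr_gt0 // ltrBlDr addrC -ltrBlDr.
Unshelve. all: by end_near. Qed.

Lemma near_rightP (P : R -> Prop) t :
  (\forall x \near t^'+, P x) <->
  exists2 c, t < c & forall x, t < x -> x < c -> P x.
Proof.
split=> [|[c ct cP]]; last by near=> x; apply: cP.
move=> /nbhs_ballP[e /= e0 eP]; exists (t + e) => [|x tx xt].
  by rewrite ltrDl.
by apply: eP => //; rewrite /ball /= distrC gtr0_norm ?subr_gt0 // ltrBlDr addrC.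
Unshelve. all: by end_near. Qed.

Lemma part_sum_cons u x (k : seq R) phi :
  part_sum u (x :: k) phi = phi u x + part_sum x k phi.
Proof. by rewrite /part_sum big_nat_recl. Qed.

Lemma part_sum_rcons u (k : seq R) x phi :
  part_sum u (rcons k x) phi = part_sum u k phi + phi (last u k) x.
Proof.
elim: k u => [|z k IH] u; first by rewrite part_sum_cons /part_sum !big_nil addrC.
by rewrite rcons_cons !part_sum_cons IH addrA.
Qed.

Lemma itv_partition_rcons a (k : seq R) x y : itv_partition a x k -> x < y ->
  itv_partition a y (rcons k y).
Proof.
case=> pk /eqP lk xy; split; last by rewrite last_rcons.
by rewrite rcons_path pk lk.
Qed.

(** A control replaces the supremum over partitions by the increments of one
nondecreasing function, which makes restriction, composition with monotone maps
and summation over partitions immediate. *)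
Definition variation_control a b (q : R) F w :=
  forall x y, a <= x -> x <= y -> y <= b -> `|F y - F x| `^ q <= w y - w x.

Lemma control_mono a b q F w : variation_control a b q F w ->
  forall x y, a <= x -> x <= y -> y <= b -> w x <= w y.
Proof.
by move=> wF x y ax xy yb; rewrite -subr_ge0 (le_trans _ (wF _ _ ax xy yb)) ?powR_ge0.
Qed.

Lemma pvariation_superadditive a q F x y : x < y ->
  (pvariation q a x F + (`|F y - F x| `^ q)%:E <= pvariation q a y F)%E.
Proof.
move=> xy; rewrite -leeBrDr //; apply: ge_ereal_sup => _ [k ka <-].
rewrite leeBrDr // -EFinD; apply: ereal_sup_ubound.
exists (rcons k y); first exact: itv_partition_rcons xy.
by case: ka => _ /eqP lk; rewrite part_sum_rcons lk.
Qed.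

Lemma pvariation_ge0 q a x F : a <= x -> (0 <= pvariation q a x F)%E.
Proof.
rewrite le_eqVlt => /predU1P[<-|ax]; apply: le_ereal_sup_tmp.
  exists 0%:E => //; exists [::]; first by split.
  by rewrite /part_sum big_nil.
exists (`|F x - F a| `^ q)%:E; last by rewrite lee_fin powR_ge0.
by exists [:: x]; [exact: itv_partition1|rewrite part_sum_cons /part_sum big_nil addr0].
Qed.

(** The control is t |-> v_q(F; [a, t]), by superadditivity of the variation. *)
Lemma Wp_control a b q F : 0 < q -> Wp q a b F ->
  exists w, variation_control a b q F w.
Proof.
move=> q0 Fq; exists (fun t => fine (pvariation q a t F)) => x y ax.
have mon u v : u <= v -> (pvariation q a u F <= pvariation q a v F)%E.
  rewrite le_eqVlt => /predU1P[->//|uv].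
  by apply: le_trans (pvariation_superadditive _ _ _ uv); rewrite leeDl // lee_fin powR_ge0.
rewrite le_eqVlt => /predU1P[<- _|xy yb].
  by rewrite !subrr normr0 powR0 // gt_eqF.
have fin z : a <= z -> z <= b -> pvariation q a z F \is a fin_num.
  move=> az zb; rewrite ge0_fin_numE ?pvariation_ge0 //.
  exact: le_lt_trans (mon _ _ zb) Fq.
have fx := fin _ ax (ltW (lt_le_trans xy yb)).
have fy := fin _ (le_trans ax (ltW xy)) yb.
rewrite lerBrDr addrC -lee_fin EFinD !fineK //; exact: pvariation_superadditive.
Qed.

Lemma powR_lt_inj (q : R) x y : 0 < q -> 0 <= y -> x `^ q < y `^ q -> x < y.
Proof.
move=> q0 y0; apply: contraTT; rewrite -!leNgt => yx.
by apply: ge0_ler_powR; rewrite ?nnegrE ?(ltW q0) // (le_trans y0).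
Qed.

(** The control, being monotone and bounded, is Cauchy on each side of [t]. *)
Lemma control_regulated a b q F w : 0 < q -> variation_control a b q F w ->
  regulated a b F.
Proof.
move=> q0 wF; have wm := control_mono wF; split=> [t /andP[at_ tb]|t /andP[at_ tb]].
  apply: cauchy_cvg; apply: cauchy_exP => e e0.
  pose E := [set w x | x in [set x | a <= x < t]].
  have Es : has_sup E.
    split; first by exists (w a); exists a => //=; rewrite lexx.
    by exists (w t) => _ [x /andP[ax xt] <-]; apply: wm => //; exact: ltW.
  have [_ [c /andP[ac ct] <-] wc] := sup_adherent (powR_gt0 q e0) Es.
  exists (F c); apply/near_leftP; exists c => // x cx xt.
  rewrite /ball /= distrC; apply: (@powR_lt_inj q) => //; first exact: ltW.
  apply: le_lt_trans (wF _ _ ac (ltW cx) (ltW (lt_le_trans xt tb))) _.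
  rewrite ltrBlDr; apply: (@le_lt_trans _ _ (sup E)); last by rewrite addrC -ltrBlDr.
  apply: ub_le_sup; first by case: Es.
  by exists x => //=; rewrite xt (le_trans ac (ltW cx)).
apply: cauchy_cvg; apply: cauchy_exP => e e0.
pose E := [set - w x | x in [set x | t < x <= b]].
have Es : has_sup E.
  split; first by exists (- w b); exists b => //=; rewrite lexx tb.
  by exists (- w t) => _ [x /andP[ax xt] <-]; rewrite lerN2; apply: wm => //; exact: ltW.
have [_ [c /andP[tc cb] <-] wc] := sup_adherent (powR_gt0 q e0) Es.
exists (F c); apply/near_rightP; exists c => // x tx xc.
rewrite /ball /=; apply: (@powR_lt_inj q) => //; first exact: ltW.
apply: le_lt_trans (wF _ _ (ltW (le_lt_trans at_ tx)) (ltW xc) cb) _.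
have : - w x <= sup E.
  apply: ub_le_sup; first by case: Es.
  by exists x => //=; rewrite tx (ltW (lt_le_trans xc cb)).
lra.
Qed.

Lemma dualW_regulated a b p F : dualW p a b F -> regulated a b F.
Proof.
case=> [[]//|[_ [q [q0 _ /(Wp_control q0)[w]]]]]; exact: control_regulated.
Qed.

Lemma regulated_osc_left a b F t e : regulated a b F -> a < t <= b -> 0 < e ->
  exists2 c, c < t & forall x y, c < x < t -> c < y < t -> `|F x - F y| <= e.
Proof.
case=> [+ _] => /[apply] /cvg_ex[l] Fl e0.
have e2 : 0 < e / 2 by rewrite divr_gt0.
move: Fl => /cvgrPdist_le /(_ _ e2) /near_leftP[c ct cP].
exists c => // x y /andP[cx xt] /andP[cy yt]; rewrite (splitr e).
rewrite -(subrKA l); apply: le_trans (ler_normD _ _) _.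
by rewrite lerD // ?cP // distrC cP.
Qed.

Lemma regulated_osc_right a b F t e : regulated a b F -> a <= t < b -> 0 < e ->
  exists2 c, t < c & forall x y, t < x < c -> t < y < c -> `|F x - F y| <= e.
Proof.
case=> [_ +] => /[apply] /cvg_ex[l] Fl e0.
have e2 : 0 < e / 2 by rewrite divr_gt0.
move: Fl => /cvgrPdist_le /(_ _ e2) /near_rightP[c ct cP].
exists c => // x y /andP[cx xt] /andP[cy yt]; rewrite (splitr e).
rewrite -(subrKA l); apply: le_trans (ler_normD _ _) _.
by rewrite lerD // ?cP // distrC cP.
Qed.

(** The class [Q] plays the role of the span of the constants and of the indicators of
half lines. Asking for [F o phi] with [phi] monotone, and not
merely for a uniformly close step function, keeps the q-variation under control.
The proof takes the supremum of the c for which the approximation exists on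
[a, c]: the left limit of [F] there shows that it is attained, the right limit
that it cannot be less than b. *)
Lemma step_approx a b F e (Q : (R -> R) -> Prop) : a < b ->
  (forall al, Q (fun=> al)) ->
  (forall G al c, a <= c < b -> Q G -> Q (fun x => G x + al * (c < x)%R%:R)) ->
  (forall G al c, a < c <= b -> Q G -> Q (fun x => G x + al * (c <= x)%R%:R)) ->
  regulated a b F -> 0 < e ->
  exists phi : R -> R, [/\ {homo phi : x y / x <= y},
    forall x, a <= phi x <= b,
    forall x, a <= x <= b -> `|F x - F (phi x)| <= e & Q (F \o phi)].
Proof.
move=> ab Qc Qgt Qge Freg e0.
pose S := [set c | a <= c <= b /\ exists phi : R -> R,
  [/\ {homo phi : x y / x <= y}, forall x, a <= phi x <= c,
    forall x, c <= x -> phi x = c,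
    forall x, a <= x <= c -> `|F x - F (phi x)| <= e & Q (F \o phi)]].
have Sa : S a.
  split; first by rewrite lexx ltW.
  exists (fun=> a); split=> //.
  - by move=> x; rewrite lexx.
  - by move=> x /le_anti <-; rewrite subrr normr0 ltW.
  - exact: Qc.
have ext c d : S c -> c < d -> d <= b ->
    (forall x y, c < x < d -> c < y < d -> `|F x - F y| <= e) -> S d.
  move=> [/andP[ac cb] [phi [phm phr phc phe Qphi]]] cd db osc.
  split; first by rewrite db (le_trans ac (ltW cd)).
  pose m := (c + d) / 2.
  have cm : c < m by rewrite /m; lra.
  have md : m < d by rewrite /m; lra.
  pose psi x := if x <= c then phi x else if x < d then m else d.
  have psc x : psi x <= d.
    rewrite /psi; case: ifP => _; last by case: ifP => // _; exact: ltW.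
    by case/andP: (phr x) => _ /le_trans; apply; exact: ltW.
  exists psi; split.
  - move=> x y xy; rewrite {1}/psi; case: ifPn => [xc|].
      rewrite /psi; case: ifPn => [yc|_]; first exact: phm.
      case/andP: (phr x) => _ /le_trans; apply.
      by case: ifPn => _; [exact: ltW|rewrite ltW].
    rewrite -ltNge => cx; have cy := lt_le_trans cx xy.
    have -> : psi y = if y < d then m else d by rewrite /psi leNgt cy.
    case: ifPn => [xd|].
      by case: ifPn => // _; exact: ltW.
    by rewrite -leNgt => dx; rewrite ltNge (le_trans dx xy).
  - move=> x; rewrite psc andbT /psi; case: ifP => _; first by case/andP: (phr x).
    by case: ifP => _; rewrite (le_trans ac) // ltW.
  - by move=> x dx; rewrite /psi leNgt (lt_le_trans cd dx) /= ltNge dx.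
  - move=> x /andP[ax xd]; rewrite /psi; case: ifPn => [xc|].
      by apply: phe; rewrite ax.
    rewrite -ltNge => cx; case: ifPn => [xd'|].
      by apply: osc; rewrite ?cx ?cm ?md.
    rewrite -leNgt => dx; have -> : x = d by apply/le_anti; rewrite xd.
    by rewrite subrr normr0 ltW.
  - have -> : F \o psi = fun x =>
        ((F \o phi) x + (F m - F c) * (c < x)%R%:R) + (F d - F m) * (d <= x)%R%:R.
      apply/funext => x; rewrite /psi /=; case: ifPn => [xc|].
        have xd := le_lt_trans xc cd.
        by rewrite ltNge xc leNgt xd /=; ring.
      rewrite -ltNge => cx; rewrite cx (phc x (ltW cx)); case: ifPn => xd.
        by rewrite leNgt xd /=; ring.
      by rewrite leNgt (negbTE xd) /=; ring.
    apply: Qge; first by rewrite db (le_lt_trans ac cd).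
    by apply: Qgt => //; rewrite ac (lt_le_trans cd db).
have hS : has_sup S.
  split; first exact: (ex_intro _ a Sa).
  by exists b => c [/andP[_ cb] _].
pose s := sup S.
have as_ : a <= s by apply: ub_le_sup => //; case: hS.
have sb : s <= b by apply: ge_sup; [exact: (ex_intro _ a Sa)|move=> c [/andP[_ cb] _]].
have Ss : S s.
  move: as_; rewrite le_eqVlt => /predU1P[<-//|as_].
  have [c cs osc] := regulated_osc_left Freg (introT andP (conj as_ sb)) e0.
  have [d Sd cd] := sup_gt (ex_intro _ a Sa) cs.
  have : d <= s by apply: ub_le_sup => //; case: hS.
  rewrite le_eqVlt => /predU1P[<-//|ds]; apply: ext Sd ds sb _ => x y.
  move=> /andP[dx xs] /andP[dy ys].
  by apply: osc; rewrite ?xs ?ys (lt_trans cd).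
have sb' : s = b.
  apply/eqP; rewrite eq_le sb leNgt; apply/negP => sltb.
  have [c sc osc] := regulated_osc_right Freg (introT andP (conj as_ sltb)) e0.
  pose d := Num.min c b.
  have sd : s < d by rewrite /d lt_min sc.
  have Sd : S d.
    apply: ext Ss sd _ _; first by rewrite /d ge_min lexx orbT.
    move=> x y; rewrite /d !lt_min => /and3P[sx xc _] /and3P[sy yc _].
    by apply: osc; rewrite ?sx ?sy.
  by have : d <= s; [apply: ub_le_sup => //; case: hS|rewrite leNgt sd].
case: Ss => _ [phi [phm phr _ phe Qphi]]; rewrite sb' in phr phe.
by exists phi; split.
Qed.

End variation.

(** * Approximation with small Riemann-Stieltjes sums *)

Section approximation.
Context {R : realType}.
Implicit Types (a b c x y t u v e al p q rr K : R) (F G h w W : R -> R) (X Y : nat -> R).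

(** The tags need not lie between consecutive points: only then is the bound stable
under changing the points and the tags by different monotone maps. *)
Definition rs_bound a b G h e := forall X Y n, sampling a b X -> sampling a b Y ->
  `|\sum_(i < n) G (Y i) * (h (X i.+1) - h (X i))| <= e.

Lemma powR_normD (q : R) x y : 0 < q -> `|x + y| `^ q <= 2 `^ q * (`|x| `^ q + `|y| `^ q).
Proof.
move=> q0; pose m := Num.max `|x| `|y|.
have m0 : 0 <= m by rewrite le_max normr_ge0.
apply: (@le_trans _ _ ((2 * m) `^ q)).
  apply: ge0_ler_powR; rewrite ?nnegrE ?normr_ge0 ?(ltW q0) ?mulr_ge0 //.
  rewrite mulr_natl mulr2n; apply: le_trans (ler_normD _ _) _.
  by rewrite lerD // le_max lexx ?orbT.
rewrite powRM // ler_wpM2l ?powR_ge0 // /m; case: (leP `|x| `|y|) => _.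
  by rewrite lerDr powR_ge0.
by rewrite lerDl powR_ge0.
Qed.

Lemma rs_bound_BV a b G h w e : a <= b ->
  (forall x y, a <= x -> x <= y -> y <= b -> `|h y - h x| <= w y - w x) ->
  (forall x, a <= x <= b -> `|G x| <= e) -> rs_bound a b G h (e * (w b - w a)).
Proof.
move=> ab hw Ge X Y n Xs Ys.
have e0 : 0 <= e by apply: le_trans (Ge a _); rewrite ?normr_ge0 ?lexx ?ab.
apply: le_trans (ler_norm_sum _ _ _) _.
apply: (@le_trans _ _ (\sum_(i < n) e * (w (X i.+1) - w (X i)))).
  apply: ler_sum => i _; rewrite normrM; apply: ler_pM => //.
    by apply: Ge; case: Ys.
  by have [aX XX Xb] := sampling_ge Xs (leqnSn i); exact: hw.
rewrite -mulr_sumr ler_wpM2l //; apply: sampling_telescope Xs => // x y ax xy yb.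
by rewrite -subr_ge0 (le_trans _ (hw _ _ ax xy yb)).
Qed.

(** [rr] is an exponent below 1/q with rr + 1/p > 1. The increments of
G = F - F o phi are at most 2e, and at most (W(y) - W(x))^(1/q) for a control [W];
interpolating, they are at most (2e)^(1 - q rr) (W(y) - W(x))^rr, whose first factor
vanishes with e. *)
Lemma rs_bound_young a b p q rr F h w wh (phi : R -> R) e :
  a <= b -> 0 < p -> 0 < q -> 0 < rr -> q * rr < 1 -> 1 < rr + p^-1 ->
  variation_control a b p h wh -> variation_control a b q F w ->
  {homo phi : x y / x <= y} -> (forall x, a <= phi x <= b) ->
  0 <= e -> (forall x, a <= x <= b -> `|F x - F (phi x)| <= e) ->
  forall K, (forall n, \sum_(m < n) riemannR (rr + p^-1) m <= K) ->
  rs_bound a b (fun x => F x - F (phi x)) h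
    (e * (wh b - wh a + 1) `^ p^-1 + (2 * e) `^ (1 - q * rr) *
      ((2 * (2 `^ q * (2 * (w b - w a)) + 1)) `^ rr *
       (2 * (wh b - wh a + 1)) `^ p^-1) * K).
Proof.
move=> ab p0 q0 rr0 qrr rp whc wc phm phr e0 Ge K zK.
set A := _ * (2 * (w b - w a)) + 1; set B := wh b - wh a + 1.
set eta := (2 * e) `^ _; pose G x := F x - F (phi x).
have wm := control_mono wc; have whm := control_mono whc.
(* the increments of W dominate the q-th powers of those of F - F o phi *)
pose W x := 2 `^ q * (w x + w (phi x)).
have phi_ord x y : x <= y -> [/\ a <= phi x, phi x <= phi y & phi y <= b].
  by move=> xy; split; [case/andP: (phr x)|exact: phm|case/andP: (phr y)].
have A0 : 0 < A.
  by rewrite /A ltr_wpDl // mulr_ge0 ?powR_ge0 // mulr_ge0 // subr_ge0 wm.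
have B0 : 0 < B by rewrite /B ltr_wpDl // subr_ge0 whm.
have p'0 : 0 < p^-1 by rewrite invr_gt0.
have hB x y : a <= x -> x <= y -> y <= b -> `|h y - h x| <= (wh y - wh x) `^ p^-1.
  move=> ax xy yb; rewrite -[leLHS](powRr1 (normr_ge0 _)) -(@mulfV _ p) ?gt_eqF //.
  rewrite powRrM; apply: ge0_ler_powR; rewrite ?nnegrE ?powR_ge0 ?(ltW p'0) ?whc //.
  by rewrite subr_ge0 whm.
have Wm x y : a <= x -> x <= y -> y <= b -> W x <= W y.
  move=> ax xy yb; have [? ? ?] := phi_ord _ _ xy.
  by rewrite ler_wpM2l ?powR_ge0 // lerD // wm.
have GW x y : a <= x -> x <= y -> y <= b -> `|G y - G x| <= eta * (W y - W x) `^ rr.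
  move=> ax xy yb; have [aphi phixy phib] := phi_ord _ _ xy.
  set d := `|_|.
  have d2 : d <= 2 * e.
    rewrite mulr_natl mulr2n; apply: le_trans (ler_normB _ _) _.
    by apply: lerD; apply: Ge; rewrite ?ax ?yb ?(le_trans xy) ?(le_trans ax).
  have dq : d `^ q <= W y - W x.
    rewrite /d (_ : G y - G x = (F y - F x) + (F (phi x) - F (phi y))); last by rewrite /G; ring.
    apply: le_trans (powR_normD _ _ q0) _.
    rewrite -mulrBr ler_wpM2l ?powR_ge0 // opprD addrACA lerD ?wc //.
    by rewrite distrC wc.
  have d0 : 0 <= d by exact: normr_ge0.
  rewrite -(powRr1 d0) -{1}(subrK (q * rr) 1) powRD; last by rewrite subrK oner_eq0.
  apply: ler_pM; rewrite ?powR_ge0 //.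
    apply: ge0_ler_powR; rewrite ?nnegrE ?mulr_ge0 // subr_ge0 ltW //.
  rewrite powRrM; apply: ge0_ler_powR; rewrite ?nnegrE ?powR_ge0 ?(ltW rr0) //.
  by rewrite subr_ge0 Wm.
have WA : W b - W a <= A.
  have [aphi phiab phib] := phi_ord _ _ ab.
  rewrite /A -mulrBr ler_wpDr // ler_wpM2l ?powR_ge0 //.
  have phiab' := le_trans aphi phiab; have phiab'' := le_trans phiab phib.
  have := wm _ _ (lexx a) aphi phiab''; have := wm _ _ phiab' phib (lexx b).
  lra.
have hBb : wh b - wh a <= B by rewrite /B ler_wpDr.
have Y' := @young_sum R a b G h wh W eta rr p^-1 A B (powR_ge0 _ _) A0 B0 rr0 p'0
  Wm whm GW hB WA hBb.
have K0 : 0 <= K by have := zK 0%N; rewrite big_ord0.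
move=> X Y [|n] Xs Ys.
  rewrite big_ord0 normr0 addr_ge0 // ?mulr_ge0 ?powR_ge0 //.
rewrite -(subrK (G (Y 0%N) * (h (X n.+1) - h (X 0%N))) (\sum_(i < _) _)) addrC.
apply: le_trans (ler_normD _ _) _; apply: lerD.
  rewrite normrM; apply: ler_pM => //; first by apply: Ge; case: Ys.
  have [aX XX Xb] := sampling_ge Xs (leq0n n.+1).
  apply: le_trans (hB _ _ aX XX Xb) _.
  have hX : wh (X n.+1) - wh (X 0%N) <= B.
    apply: le_trans hBb; rewrite lerB // whm //; [exact: le_trans XX|exact: le_trans Xb].
  by apply: ge0_ler_powR; rewrite ?nnegrE ?(ltW p'0) ?(ltW B0) ?subr_ge0 ?whm.
apply: le_trans (Y' n X Y Xs Ys) _.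
by rewrite -mulr_sumr ler_wpM2l // ?mulr_ge0 ?powR_ge0.
Qed.

(** In the case p > 1 the exponent rr is the midpoint of 1 - 1/p and 1/q, and e1 makes
each of the two terms of [rs_bound_young] at most e/2. *)
Lemma dualW_approx a b p F h e (Q : (R -> R) -> Prop) : a < b -> 1 <= p ->
  dualW p a b F -> Wp p a b h ->
  (forall al, Q (fun=> al)) ->
  (forall G al c, a <= c < b -> Q G -> Q (fun x => G x + al * (c < x)%R%:R)) ->
  (forall G al c, a < c <= b -> Q G -> Q (fun x => G x + al * (c <= x)%R%:R)) ->
  0 < e ->
  exists F', [/\ Q F', forall x, a <= x <= b -> `|F x - F' x| <= e &
    rs_bound a b (fun x => F x - F' x) h e].
Proof.
move=> ab p1 Fp hp Qc Qgt Qge e0.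
have p0 : 0 < p by exact: lt_le_trans p1.
have Freg := dualW_regulated Fp.
have [wh whc] := Wp_control p0 hp.
have D0 : 0 <= wh b - wh a by rewrite subr_ge0 (control_mono whc) // ltW.
case: Fp => [[p_1 _]|[{}p1 [q [q0 pq Fq]]]].
  pose e1 := e / (wh b - wh a + 1).
  have e10 : 0 < e1 by rewrite divr_gt0 // ltr_wpDl.
  have [phi [phm phr phe Qphi]] := step_approx ab Qc Qgt Qge Freg e10.
  have D1 : e1 <= e by rewrite ler_pdivrMr ?ltr_wpDl // ler_peMr ?lerDr // ltW.
  exists (F \o phi); split=> // [x xab|X Y n Xs Ys].
    exact: le_trans (phe _ xab) D1.
  apply: (@le_trans _ _ (e1 * (wh b - wh a))).
    apply: (@rs_bound_BV a b _ h wh e1 _ _ phe) Xs Ys; first exact: ltW.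
    move=> x y ax xy yb; have := whc _ _ ax xy yb.
    by rewrite p_1 powRr1.
  rewrite /e1 mulrAC ler_pdivrMr ?ltr_wpDl // ler_wpM2l ?ltW //.
  by rewrite ltrDl.
have [w wc] := Wp_control q0 Fq.
pose rr := (1 - p^-1 + q^-1) / 2.
have pi1 : p^-1 < 1 by rewrite invf_lt1.
have rr0 : 0 < rr by rewrite /rr; lra.
have rrq : rr < q^-1 by rewrite /rr; lra.
have qrr : q * rr < 1 by rewrite -ltr_pdivlMl // mulr1.
have rp : 1 < rr + p^-1 by rewrite /rr; lra.
have [K K0 zK] := riemannR_bounded rp.
pose C1 := (wh b - wh a + 1) `^ p^-1.
pose C2 := (2 * (2 `^ q * (2 * (w b - w a)) + 1)) `^ rr *
       (2 * (wh b - wh a + 1)) `^ p^-1 * K.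
have C10 : 0 <= C1 by exact: powR_ge0.
have C20 : 0 <= C2 by rewrite mulr_ge0 // mulr_ge0 ?powR_ge0.
have de0 : 0 < 1 - q * rr by rewrite subr_gt0.
pose e2 := e / (2 * (C1 + 1)); pose e3 := (e / (2 * (C2 + 1))) `^ (1 - q * rr)^-1 / 2.
have e20 : 0 < e2 by rewrite divr_gt0 // mulr_gt0 // ltr_wpDl.
have e30' : 0 < e / (2 * (C2 + 1)) by rewrite divr_gt0 // mulr_gt0 // ltr_wpDl.
have e30 : 0 < e3 by rewrite divr_gt0 // powR_gt0.
pose e1 := Num.min e (Num.min e2 e3).
have e10 : 0 < e1 by rewrite !lt_min e0 e20.
have [phi [phm phr phe Qphi]] := step_approx ab Qc Qgt Qge Freg e10.
exists (F \o phi); split=> // [x xab|X Y n Xs Ys].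
  by apply: le_trans (phe _ xab) _; rewrite ge_min lexx.
apply: (@le_trans _ _ (e1 * C1 + (2 * e1) `^ (1 - q * rr) * C2)).
  rewrite /C1 /C2 [X in _ <= _ + X]mulrA.
  exact: (rs_bound_young (ltW ab) p0 q0 rr0 qrr rp whc wc phm phr (ltW e10) phe zK).
rewrite (splitr e); apply: lerD.
  apply: (@le_trans _ _ (e2 * C1)).
    by rewrite ler_wpM2r // !ge_min lexx orbT.
  rewrite /e2 mulrAC ler_pdivrMr; last by rewrite mulr_gt0 // ltr_wpDl.
  by rewrite mulrA divfK // ler_pM2l // lerDl.
apply: (@le_trans _ _ (e / (2 * (C2 + 1)) * C2)).
  rewrite ler_wpM2r // (_ : e / _ = (2 * e3) `^ (1 - q * rr)); last first.
    have -> : 2 * e3 = (e / (2 * (C2 + 1))) `^ (1 - q * rr)^-1 by rewrite /e3; field.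
    by rewrite -powRrM mulVf ?gt_eqF // powRr1 // ltW.
  have e13 : 2 * e1 <= 2 * e3 by rewrite ler_pM2l // !ge_min lexx !orbT.
  have e1' : 0 <= 2 * e1 by rewrite mulr_ge0 // ltW.
  by apply: ge0_ler_powR; rewrite ?nnegrE ?(ltW de0) ?(le_trans e1').
rewrite mulrAC ler_pdivrMr; last by rewrite mulr_gt0 // ltr_wpDl.
by rewrite [leRHS]mulrA divfK // ler_pM2l // lerDl.
Qed.

End approximation.

(** * One-sided modifications and sums of products of jumps *)

Section estimates.
Context {R : realType}.
Implicit Types (a b c x y t u v e l : R) (F G h w W : R -> R) (X Y : nat -> R).
Implicit Types (d : bool) (k xs : seq R).

Definition tag_pt d x y := if d then x else y.
(** The refinement integral that enters the Young integral of [F dh] on side [d] is that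
of [mod_at d F] against [mod_at (~~ d) h]. *)
Definition mod_at d u v F := if d then left_mod u F else right_mod v F.
Definition jump d F x := if d then ljump F x else rjump F x.

Lemma lim_norm_le (T : Type) (FF : set_system T) (f : T -> R) l e :
  ProperFilter FF -> f @ FF --> l -> (\forall x \near FF, `|f x| <= e) -> `|l| <= e.
Proof.
move=> PF fl fe; apply/ler_addgt0Pr => z z0.
have : \forall x \near FF, `|l| <= e + z.
  move: fl => /cvgrPdist_le /(_ _ z0); apply: filterS2 fe => x fx lx.
  rewrite -(subrK (f x) l) addrC; apply: le_trans (ler_normD _ _) _.
  exact: lerD.
by case/filter_ex.
Qed.

Lemma sampling_nth u v k : itv_partition u v k -> sampling u v (nth v (u :: k)).
Proof.
move=> kuv; have [pk /eqP lk] := kuv; pose X := nth v (u :: k).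
have Xv i : (size k <= i)%N -> X i = v.
  rewrite leq_eqVlt => /predU1P[<-|ki]; last by rewrite /X nth_default.
  by rewrite /X -[size k]/(size (u :: k)).-1 nth_last.
have Xm i j : (i <= j)%N -> X i <= X j.
  apply: (homo_leq (@lexx _ R) (@le_trans _ R)) => {}i.
  have [ki|ik] := leqP (size k) i; first by rewrite !Xv // ltnW.
  by move/(pathP v) : pk => /(_ _ ik) /ltW.
split=> // i; apply/andP; split; first exact: (Xm 0%N i).
by rewrite -[leRHS](Xv (i + size k)%N) ?leq_addl // Xm ?leq_addr.
Qed.

Lemma sampling_sub a b u v X : a <= u -> v <= b -> sampling u v X -> sampling a b X.
Proof.
move=> au vb [Xm Xuv]; split=> // i; have /andP[uX Xv] := Xuv i.
by rewrite (le_trans au) //= (le_trans Xv).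
Qed.

Lemma sampling_tags u v k (y : seq R) : itv_partition u v k -> tags u k y ->
  sampling u v (nth v y).
Proof.
move=> kuv [sz tg]; have [Xm Xuv] := sampling_nth kuv.
have yX i : (i < size k)%N -> nth v (u :: k) i <= nth v y i <= nth v (u :: k) i.+1.
  move=> ik; rewrite (set_nth_default 0) 1?ltnW //.
  by rewrite (set_nth_default 0 v) ?sz // (set_nth_default 0 v) //; exact: tg.
have yuv i : u <= nth v y i <= v.
  have [ki|ik] := leqP (size k) i.
    by rewrite nth_default ?sz // lexx (itv_partition_le kuv).
  have /andP[Xy yX'] := yX _ ik.
  have /andP[uX _] := Xuv i; have /andP[_ Xv] := Xuv i.+1.
  by rewrite (le_trans uX) //= (le_trans yX').
split=> // i j; apply: (homo_leq (@lexx _ R) (@le_trans _ R)) => {i j} i.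
have [ki|ik] := leqP (size k) i.+1.
  by rewrite [leRHS]nth_default ?sz //; have /andP[] := yuv i.
have /andP[_] := yX _ (ltnW ik); have /andP[+ _] := yX _ ik.
by move=> /[swap] /le_trans; exact.
Qed.

Lemma rs_bound_RS_sum a b G h e u v k (y : seq R) : rs_bound a b G h e ->
  a <= u -> v <= b -> itv_partition u v k -> tags u k y ->
  `|RS_sum u k y G h| <= e.
Proof.
move=> Ge au vb kuv tg.
rewrite /RS_sum big_mkord.
under eq_bigr => i _.
  have i0 : (i < size (u :: k))%N := ltnW (ltn_ord i).
  have i1 : (i.+1 < size (u :: k))%N := ltn_ord i.
  rewrite !(set_nth_default v 0) //; last by case: tg => ->.
  over.
by apply: (Ge (nth v (u :: k)) (nth v y)); apply: sampling_sub au vb _; [exact: sampling_nth|exact: sampling_tags tg].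
Qed.

Lemma rs_bound_part_sum a b G h e u v k d : rs_bound a b G h e ->
  a <= u -> v <= b -> itv_partition u v k ->
  `|part_sum u k (fun x y => G (tag_pt d x y) * (h y - h x))| <= e.
Proof.
move=> Ge au vb kuv; have Xs := sampling_sub au vb (sampling_nth kuv).
rewrite /part_sum big_mkord.
under eq_bigr => i _.
  have i0 : (i < size (u :: k))%N := ltnW (ltn_ord i).
  have i1 : (i.+1 < size (u :: k))%N := ltn_ord i.
  rewrite !(set_nth_default v 0) //.
  over.
have Ys : sampling a b (fun i => nth v (u :: k) (if d then i else i.+1)).
  by case: Xs => Xm Xab; split=> [i j ij|i]; case: d => //; apply: Xm.
by have := Ge _ _ (size k) Xs Ys; case: d {Ys}.
Qed.

Lemma left_approach c y : c < y -> Num.max c (y - z) @[z --> 0^'+] --> y^'-.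
Proof.
move=> cy A /near_leftP[c1 c1y cA]; apply/near_rightP.
exists (Num.min (y - c1) (y - c)); first by rewrite lt_min !subr_gt0 c1y.
move=> z z0; rewrite lt_min => /andP[zc1 zc].
change (A (Num.max c (y - z))).
have -> : Num.max c (y - z) = y - z by rewrite max_r // ltW //; lra.
by apply: cA; lra.
Qed.

Lemma right_approach c y : y < c -> Num.min c (y + z) @[z --> 0^'+] --> y^'+.
Proof.
move=> yc A /near_rightP[c1 c1y cA]; apply/near_rightP.
exists (Num.min (c1 - y) (c - y)); first by rewrite lt_min !subr_gt0 c1y.
move=> z z0; rewrite lt_min => /andP[zc1 zc].
change (A (Num.min c (y + z))).
have -> : Num.min c (y + z) = y + z by rewrite min_r // ltW //; lra.
by apply: cA; lra.
Qed.

Lemma regulated_llim a b F t : regulated a b F -> a < t <= b ->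
  F x @[x --> t^'-] --> llim F t.
Proof. by case=> + _ => /[apply]. Qed.

Lemma regulated_rlim a b F t : regulated a b F -> a <= t < b ->
  F x @[x --> t^'+] --> rlim F t.
Proof. by case=> _ + => /[apply]. Qed.

(** As z decreases to 0, [F \o shift_at d u v z] tends pointwise on [u, v] to
[mod_at d u v F]. *)
Definition shift_at d u v z x := if d then Num.max u (x - z) else Num.min v (x + z).

Lemma shift_at_homo d u v z : {homo shift_at d u v z : x y / x <= y}.
Proof.
move=> x y xy; rewrite /shift_at; case: d; first by rewrite ge_max !le_max lexx lerD2r xy orbT.
by rewrite le_min !ge_min lexx lerD2r xy orbT.
Qed.

Lemma shift_at_in d u v z x : 0 < z -> u <= x <= v -> u <= shift_at d u v z x <= v.
Proof.
move=> z0 /andP[ux xv]; rewrite /shift_at; case: d.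
  rewrite le_max lexx /= ge_max (le_trans ux) //=; lra.
rewrite ge_min lexx /= andbT le_min (le_trans ux) //=; lra.
Qed.

Lemma mod_at_cvg a b F u v d x : regulated a b F -> a <= u -> v <= b ->
  u <= x <= v -> F (shift_at d u v z x) @[z --> 0^'+] --> mod_at d u v F x.
Proof.
move=> Fr au vb /andP[ux xv]; rewrite /mod_at /shift_at; case: d.
  rewrite /left_mod; case: ifPn => [{}ux|].
    apply: cvg_comp (left_approach ux) _; apply: (regulated_llim Fr).
    by rewrite (le_lt_trans au) // (le_trans xv).
  rewrite -leNgt => xu; have -> : x = u by apply/le_anti; rewrite xu.
  apply: cvg_near_cst; near=> z.
  by rewrite max_l // gerBl.
rewrite /right_mod; case: ifPn => [{}xv|].
  apply: cvg_comp (right_approach xv) _; apply: (regulated_rlim Fr).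
  by rewrite (le_trans au) // (lt_le_trans xv).
rewrite -leNgt => vx; have -> : x = v by apply/le_anti; rewrite xv.
apply: cvg_near_cst; near=> z.
by rewrite min_l // lerDl.
Unshelve. all: by end_near. Qed.

(** The modified functions are pointwise limits of monotone reparametrizations of [G]
and [h], and the bound is stable under both operations. *)
Lemma rs_bound_mod a b G h e u v d d' : regulated a b G -> regulated a b h ->
  rs_bound a b G h e -> a <= u -> v <= b ->
  rs_bound u v (mod_at d u v G) (mod_at d' u v h) e.
Proof.
move=> Gr hr Ge au vb X Y n Xs Ys.
apply: (@lim_norm_le _ (0^'+ : set_system R) (fun z => \sum_(i < n)
   G (shift_at d u v z (Y i)) *
     (h (shift_at d' u v z (X i.+1)) - h (shift_at d' u v z (X i))))).
  apply: cvg_big => [|i _]; first exact: add_continuous.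
   case: Xs => _ Xs; case: Ys => _ Ys.
  apply: cvgM; first exact: mod_at_cvg Gr au vb _.
  by apply: cvgB; exact: mod_at_cvg hr au vb _.
near=> z; apply: (Ge (shift_at d' u v z \o X) (shift_at d u v z \o Y));
  apply: sampling_sub au vb _.
  case: Xs => Xm Xs; split=> [i j ij|i]; first exact/shift_at_homo/Xm.
  exact: shift_at_in.
case: Ys => Ym Ys; split=> [i j ij|i]; first exact/shift_at_homo/Ym.
exact: shift_at_in.
Unshelve. all: by end_near. Qed.

Definition interleave (l r : nat -> R) j := if odd j then r j./2 else l j./2.

Lemma interleave_sampling a b (l r : nat -> R) :
  (forall i, [/\ a <= l i, l i <= r i, r i <= l i.+1 & l i.+1 <= b]) ->
  sampling a b (interleave l r).
Proof.
move=> lr; have lb i : a <= l i <= b.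
  by have [? ? ? ?] := lr i; apply/andP; split=> //; lra.
split=> [i j|i]; last first.
  rewrite /interleave; case: ifP => _ //; have [? ? ? ?] := lr i./2; lra.
apply: (homo_leq (@lexx _ R) (@le_trans _ R)) => {i j} i.
rewrite /interleave /= uphalf_half; have [? ? ? ?] := lr i./2.
by case: (odd i) => //=.
Qed.

(** Take the points l_0, r_0, l_1, r_1, ... and compare the tags n_0, n_0, n_1, n_1, ...
with the tags m_0, n_0, m_1, n_1, ...: the difference of the two Riemann-Stieltjes
sums is the sum to be bounded. *)
Lemma rs_bound_pairs a b G h e (l r m n : nat -> R) N : rs_bound a b G h e ->
  (forall i, [/\ a <= l i, l i <= r i, r i <= l i.+1 & l i.+1 <= b]) ->
  (forall i, [/\ a <= m i, m i <= n i, n i <= m i.+1 & m i.+1 <= b]) ->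
  `|\sum_(i < N) (G (n i) - G (m i)) * (h (r i) - h (l i))| <= e *+ 2.
Proof.
move=> Ge lr mn; have Xs := interleave_sampling lr.
have Ys2 := interleave_sampling mn.
have Ys1 : sampling a b (interleave n n).
  apply: interleave_sampling => i.
  by have [? ? ? ?] := mn i; have [? ? ? ?] := mn i.+1; split; lra.
have := lerD (Ge _ _ N.*2 Xs Ys1) (Ge _ _ N.*2 Xs Ys2).
rewrite -mulr2n; apply: le_trans; apply: le_trans (ler_normB _ _).
rewrite le_eqVlt; apply/orP; left; apply/eqP; congr `|_|.
elim: N => [|N IH]; first by rewrite !big_ord0 subrr.
rewrite doubleS !big_ord_recr /= IH /interleave /= odd_double /= !doubleK.
by rewrite uphalf_double; ring.
Qed.

(** A product of jumps is the limit of products of increments over shrinking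
intervals on the two sides of a point, and [rs_bound_pairs] bounds the sums of
those. Clamping the intervals at the neighbouring points keeps the samplings
monotone for every length [dl]. *)
Lemma rs_bound_jumps a b G h e xs d : a < b -> regulated a b G -> regulated a b h ->
  rs_bound a b G h e -> sorted <%R xs -> (forall x, x \in xs -> a < x < b) ->
  `|\sum_(x <- xs) jump d G x * jump (~~ d) h x| <= e *+ 2.
Proof.
move=> ab Gr hr Ge srt xab.
(* the points xs between the end points: z 0 = a and z i.+1 = nth b xs i *)
pose z := nth b (a :: rcons xs b).
have [zs zlt] : sampling a b z /\ forall i, (i < size xs)%N -> z i < z i.+1 < z i.+2.
  have kab : itv_partition a b (rcons xs b).
    split; last by rewrite last_rcons.
    rewrite rcons_path path_min_sorted ?srt /=; last first.
      by apply/allP => x /xab /andP[].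
    by have := mem_last a xs; rewrite inE => /predU1P[->//|/xab /andP[]].
  split; first exact: sampling_nth.
  move=> i ixs; case: kab => /(pathP b) kab _.
  by apply/andP; split; apply: kab; rewrite size_rcons // ltnS ltnW.
have zn i : (i < size xs)%N -> z i.+1 = nth b xs i.
  by move=> ixs; rewrite /z /= nth_rcons ixs.
pose lft d dl i := if d then Num.max (z i) (z i.+1 - dl) else z i.+1.
pose rgt d dl i := if d then z i.+1 else Num.min (z i.+2) (z i.+1 + dl).
have lr d' dl i : 0 < dl -> [/\ a <= lft d' dl i, lft d' dl i <= rgt d' dl i,
    rgt d' dl i <= lft d' dl i.+1 & lft d' dl i.+1 <= b].
  move=> dl0; have [az z01 zb] := sampling_ge zs (leqnSn i).
  have [_ z12 z2b] := sampling_ge zs (leqnSn i.+1).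
  rewrite /lft /rgt; case: d'; split=> //.
  - by rewrite le_max az.
  - by rewrite ge_max z01 gerBl ltW.
  - by rewrite le_max lexx.
  - by rewrite ge_max zb /= (le_trans _ z2b) // gerBl ltW.
  - exact: le_trans z01.
  - by rewrite le_min z12 lerDl ltW.
  - by rewrite ge_min lexx.
have jl d' H i : regulated a b H -> (i < size xs)%N ->
    H (rgt d' dl i) - H (lft d' dl i) @[dl --> 0^'+] --> jump d' H (z i.+1).
  move=> Hr ixs; have /andP[z01 z12] := zlt _ ixs.
  have [az _ z2b] := sampling_ge zs (leq_addl 2 i).
  rewrite /lft /rgt /jump; case: d'; apply: cvgB; try exact: cvg_cst.
    apply: cvg_comp (left_approach z01) _; apply: (regulated_llim Hr).
    by rewrite (le_lt_trans az) // (le_trans (ltW z12)).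
  apply: cvg_comp (right_approach z12) _; apply: (regulated_rlim Hr).
  by rewrite (le_trans az) ?(ltW z01) // (lt_le_trans z12).
rewrite (big_nth b) big_mkord.
apply: (@lim_norm_le _ (0^'+ : set_system R) (fun dl => \sum_(i < size xs)
   (G (rgt d dl i) - G (lft d dl i)) * (h (rgt (~~ d) dl i) - h (lft (~~ d) dl i)))).
  apply: cvg_big => [|i _]; first exact: add_continuous.
  by rewrite -zn //; apply: cvgM; exact: jl.
near=> dl; apply: (rs_bound_pairs _ Ge (l := lft (~~ d) dl) (r := rgt (~~ d) dl)
  (m := lft d dl) (n := rgt d dl)) => i; exact: lr.
Unshelve. all: by end_near. Qed.

End estimates.

(** * Indefinite integrals and their linearity in the integrand *)

Section linearity.
Context {R : realType}.
Implicit Types (a b c x y t u v e l al J I : R) (F G h Phi : R -> R).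
Implicit Types (d : bool) (k : seq R) (lam : nat -> seq R).

Lemma itv_partition_mem u v k x : itv_partition u v k -> x \in k -> u < x <= v.
Proof.
move=> kuv xk; have [pk _] := kuv.
rewrite (allP (order_path_min lt_trans pk)) //=.
have [_ /(_ (index x k).+1)] := sampling_nth kuv.
by rewrite /= nth_index // => /andP[].
Qed.

Lemma itv_partition_refine u v k1 k2 : u < v ->
  itv_partition u v k1 -> itv_partition u v k2 ->
  exists k, [/\ itv_partition u v k, {subset k1 <= k} & {subset k2 <= k}].
Proof.
move=> uv k1uv k2uv.
pose s := sort <=%R [seq x <- undup (k1 ++ k2) | x < v].
have kuv x : x \in k1 ++ k2 -> u < x <= v.
  by rewrite mem_cat => /orP[]; exact: itv_partition_mem.
have ms x : (x \in s) = (x < v) && (x \in k1 ++ k2).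
  by rewrite mem_sort mem_filter mem_undup.
have subk x : x \in k1 ++ k2 -> x \in rcons s v.
  move=> xk; rewrite mem_rcons inE ms xk andbT.
  by have /andP[_] := kuv _ xk; rewrite le_eqVlt.
exists (rcons s v); split; [|by move=> x xk; apply: subk; rewrite mem_cat xk ?orbT..].
split; last by rewrite last_rcons.
rewrite rcons_path path_min_sorted; last first.
  by apply/allP => x; rewrite ms => /andP[_ /kuv /andP[]].
rewrite sort_lt_sorted filter_uniq ?undup_uniq //=.
by have := mem_last u s; rewrite inE => /predU1P[->//|]; rewrite ms => /andP[].
Qed.

(** The refinement integral as a limit along a filter of tagged partitions, so that
uniqueness, linearity and the Cauchy criterion come from the theory of filters. *)
Definition rrs_filter u v : set_system (seq R * seq R) :=
  fun P => exists k0, itv_partition u v k0 /\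
    forall k (y : seq R), itv_partition u v k -> {subset k0 <= k} -> tags u k y ->
      P (k, y).

Lemma tags_self u v k : itv_partition u v k -> tags u k k.
Proof.
move=> [pk _]; split=> // i ik; rewrite lexx andbT.
by move/(pathP 0) : pk => /(_ _ ik) /ltW.
Qed.

Lemma rrs_filter_proper u v : u < v -> ProperFilter (rrs_filter u v).
Proof.
move=> uv; split.
  by move=> [k [kuv /(_ k k kuv)]]; apply=> //; exact: tags_self kuv.
split.
- by exists [:: v]; split=> //; exact: itv_partition1.
- move=> P P' [k [kuv kP]] [k' [kuv' kP']].
  have [k'' [kuv'' sk sk']] := itv_partition_refine uv kuv kuv'.
  exists k''; split=> // l y luv sl tl; split.
    by apply: kP => // x /sk /sl.
  by apply: kP' => // x /sk' /sl.
- move=> P P' PP' [k [kuv kP]]; exists k; split=> // l y luv kl tl.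
  exact/PP'/kP.
Qed.

Lemma is_RRSE u v F h I : u < v ->
  is_RRS u v F h I <-> RS_sum u ky.1 ky.2 F h @[ky --> rrs_filter u v] --> I.
Proof.
move=> uv; have FF := rrs_filter_proper uv; split=> [RRS|/cvgrPdist_lt RRS].
  apply/cvgrPdist_lt => e e0; have [k0 [k0uv k0P]] := RRS _ e0.
  by exists k0; split=> // k y kuv k0k tk /=; rewrite distrC; exact: k0P.
move=> e e0; have [k0 [k0uv k0P]] := RRS _ e0.
exists k0; split=> // k y kuv k0k tk; rewrite distrC.
exact: (k0P k y kuv k0k tk).
Qed.

(** [lval] and [rval] are the factors of the jumps of the integrator in the left and
right jumps of an indefinite integral. *)
Definition lval d F t := if d then llim F t else F t.
Definition rval d F s := if d then F s else rlim F s.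

(** For d = true the sign is 1 and the boundary term sits at [u]; for d = false the sign
is -1 and it sits at [v]. *)
Definition young_value d u v F h I := exists J S,
  [/\ is_RRS u v (mod_at d u v F) (mod_at (~~ d) u v h) J,
    is_usum [set x | u < x < v] (fun x => jump d F x * jump (~~ d) h x) S &
    I = J + F (tag_pt d u v) * jump (~~ d) h (tag_pt d u v) + (-1) ^+ (~~ d) * S].

(** [Phi] is an indefinite integral both along lambda and in the sense of Young. The
jumps are stated as limits, so that they also yield that [Phi] is regulated. *)
Definition indef_integral d a b lam F h Phi :=
  [/\ forall u v, a <= u -> u < v -> v <= b ->
        lam_sum_cvg lam u v (fun x y => F (tag_pt d x y) * (h y - h x)) (Phi v - Phi u),
      forall u v, a <= u -> u < v -> v <= b -> young_value d u v F h (Phi v - Phi u),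
      forall t, a < t <= b -> Phi x @[x --> t^'-] --> Phi t - lval d F t * ljump h t &
      forall s, a <= s < b -> Phi x @[x --> s^'+] --> Phi s + rval d F s * rjump h s].

Definition integrable d a b lam h F :=
  regulated a b F /\ exists Phi, indef_integral d a b lam F h Phi.

Lemma regulated_lin a b F G al : regulated a b F -> regulated a b G ->
  regulated a b (fun x => F x + al * G x).
Proof.
move=> [Fl Fr] [Gl Gr]; split=> t tab.
  by apply: is_cvgD; [exact: Fl|apply: is_cvgM; [exact: is_cvg_cst|exact: Gl]].
by apply: is_cvgD; [exact: Fr|apply: is_cvgM; [exact: is_cvg_cst|exact: Gr]].
Qed.

Lemma llim_lin a b F G al t : regulated a b F -> regulated a b G -> a < t <= b ->
  llim (fun x => F x + al * G x) t = llim F t + al * llim G t.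
Proof.
move=> Fr Gr tab; apply: cvg_lim => //; apply: cvgD; first exact: regulated_llim Fr tab.
by apply: cvgM; [exact: cvg_cst|exact: regulated_llim Gr tab].
Qed.

Lemma rlim_lin a b F G al t : regulated a b F -> regulated a b G -> a <= t < b ->
  rlim (fun x => F x + al * G x) t = rlim F t + al * rlim G t.
Proof.
move=> Fr Gr tab; apply: cvg_lim => //; apply: cvgD; first exact: regulated_rlim Fr tab.
by apply: cvgM; [exact: cvg_cst|exact: regulated_rlim Gr tab].
Qed.

Lemma mod_at_lin a b F G al d u v x : regulated a b F -> regulated a b G ->
  a <= u -> v <= b -> u <= x <= v ->
  mod_at d u v (fun x => F x + al * G x) x = mod_at d u v F x + al * mod_at d u v G x.
Proof.
move=> Fr Gr au vb /andP[ux xv]; rewrite /mod_at /left_mod /right_mod; case: d.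
  case: ifPn => // ux'; apply: llim_lin Fr Gr _.
  by rewrite (le_lt_trans au ux') (le_trans xv).
case: ifPn => // ux'; apply: rlim_lin Fr Gr _.
by rewrite (lt_le_trans ux' vb) (le_trans au).
Qed.

Lemma jump_lin a b F G al d x : regulated a b F -> regulated a b G -> a < x < b ->
  jump d (fun x => F x + al * G x) x = jump d F x + al * jump d G x.
Proof.
move=> Fr Gr /andP[ax xb]; rewrite /jump /ljump /rjump; case: d.
  by rewrite (llim_lin _ Fr Gr) ?ax ?ltW //; ring.
by rewrite (rlim_lin _ Fr Gr) ?xb ?ltW //; ring.
Qed.

Lemma lval_lin a b F G al d t : regulated a b F -> regulated a b G -> a < t <= b ->
  lval d (fun x => F x + al * G x) t = lval d F t + al * lval d G t.
Proof. by move=> Fr Gr tab; rewrite /lval; case: d => //; exact: llim_lin Fr Gr tab. Qed.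

Lemma rval_lin a b F G al d t : regulated a b F -> regulated a b G -> a <= t < b ->
  rval d (fun x => F x + al * G x) t = rval d F t + al * rval d G t.
Proof. by move=> Fr Gr tab; rewrite /rval; case: d => //; exact: rlim_lin Fr Gr tab. Qed.

Lemma tag_sum_lin u k d F G h al :
  part_sum u k (fun x y => (fun x => F x + al * G x) (tag_pt d x y) * (h y - h x)) =
  part_sum u k (fun x y => F (tag_pt d x y) * (h y - h x)) +
  al * part_sum u k (fun x y => G (tag_pt d x y) * (h y - h x)).
Proof.
by rewrite /part_sum mulr_sumr -big_split; apply: eq_bigr => i _ /=; ring.
Qed.

Lemma tags_mem u v k (y : seq R) i : itv_partition u v k -> tags u k y ->
  (i < size k)%N -> u <= nth 0 y i <= v.
Proof.
move=> kuv tg ik; have [_ /(_ i)] := sampling_tags kuv tg.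
by rewrite (set_nth_default 0) //; case: tg => ->.
Qed.

Lemma RS_sum_lin a b F G H al d u v k (y : seq R) : regulated a b F -> regulated a b G ->
  a <= u -> v <= b -> itv_partition u v k -> tags u k y ->
  RS_sum u k y (mod_at d u v (fun x => F x + al * G x)) H =
  RS_sum u k y (mod_at d u v F) H + al * RS_sum u k y (mod_at d u v G) H.
Proof.
move=> Fr Gr au vb kuv tg; rewrite /RS_sum !big_mkord mulr_sumr -big_split.
apply: eq_bigr => i _ /=.
by rewrite (mod_at_lin _ _ Fr Gr) ?(tags_mem kuv tg) //; ring.
Qed.

Definition jump_term d u v F h x : R :=
  patch (fun=> 0) [set x | u < x < v] (fun x => jump d F x * jump (~~ d) h x) x.

Lemma jump_term_lin a b F G h al d u v x : regulated a b F -> regulated a b G ->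
  a <= u -> v <= b ->
  jump_term d u v (fun x => F x + al * G x) h x =
  jump_term d u v F h x + al * jump_term d u v G h x.
Proof.
move=> Fr Gr au vb; rewrite /jump_term !patchE; case: ifPn; last by rewrite mulr0 addr0.
rewrite inE /= => /andP[ux xv]; rewrite (jump_lin _ _ Fr Gr); first by ring.
by rewrite (le_lt_trans au ux) (lt_le_trans xv).
Qed.

Lemma partial_sum_lin a b F G h al d u v (A : {fset R}) :
  regulated a b F -> regulated a b G -> a <= u -> v <= b ->
  partial_sum (jump_term d u v (fun x => F x + al * G x) h) A =
  partial_sum (jump_term d u v F h) A + al * partial_sum (jump_term d u v G h) A.
Proof.
move=> Fr Gr au vb; rewrite /partial_sum mulr_sumr -big_split.
by apply: eq_bigr => i _; exact: jump_term_lin Fr Gr au vb.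
Qed.

Lemma integrable_lin d a b lam h F G al : integrable d a b lam h F ->
  integrable d a b lam h G -> integrable d a b lam h (fun x => F x + al * G x).
Proof.
move=> [Fr [P [P1 P2 P3 P4]]] [Gr [Q [Q1 Q2 Q3 Q4]]].
split; first exact: regulated_lin.
have EQ (x y : R) : P x + al * Q x - (P y + al * Q y) = P x - P y + al * (Q x - Q y).
  by ring.
exists (fun x => P x + al * Q x); split.
- move=> u v au uv vb; rewrite EQ /lam_sum_cvg.
  under eq_cvg do rewrite tag_sum_lin.
  apply: cvgD; first exact: (P1 _ _ au uv vb).
  by apply: cvgM; [exact: cvg_cst|exact: (Q1 _ _ au uv vb)].
- move=> u v au uv vb; rewrite EQ.
  have [J [S [/(is_RRSE _ _ _ uv) HJ HS ->]]] := P2 _ _ au uv vb.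
  have [J' [S' [/(is_RRSE _ _ _ uv) HJ' HS' ->]]] := Q2 _ _ au uv vb.
  exists (J + al * J'), (S + al * S'); split; last by ring.
    apply/(is_RRSE _ _ _ uv); have FF := rrs_filter_proper uv.
    apply: (cvg_trans _ (cvgD HJ (cvgM (cvg_cst al) HJ'))); apply: near_eq_cvg.
    exists [:: v]; split=> [|k y kuv _ tk]; first exact: itv_partition1.
    by rewrite /= (RS_sum_lin _ _ _ Fr Gr au vb kuv tk).
  rewrite /is_usum -/(jump_term d u v _ h).
  have -> : partial_sum (jump_term d u v (fun x => F x + al * G x) h) =
    (fun A => partial_sum (jump_term d u v F h) A
              + al * partial_sum (jump_term d u v G h) A).
    by apply/funext => A; exact: partial_sum_lin Fr Gr au vb.
  have TF := @totally_filter R.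
  by apply: cvgD => //; apply: cvgM => //; exact: cvg_cst.
- move=> t tab; rewrite (lval_lin _ _ Fr Gr tab) (_ : _ - _ =
    P t - lval d F t * ljump h t + al * (Q t - lval d G t * ljump h t)); last by ring.
  apply: cvgD; first exact: P3.
  by apply: cvgM; [exact: cvg_cst|exact: Q3].
- move=> t tab; rewrite (rval_lin _ _ Fr Gr tab) (_ : _ + _ =
    P t + rval d F t * rjump h t + al * (Q t + rval d G t * rjump h t)); last by ring.
  apply: cvgD; first exact: P4.
  by apply: cvgM; [exact: cvg_cst|exact: Q4].
Qed.

End linearity.

(** * Stability under approximation of the integrand *)

Section stability.
Context {R : realType}.
Implicit Types (a b c x y t u v e z l al J I : R) (F G h Phi : R -> R).
Implicit Types (d : bool) (k : seq R) (lam : nat -> seq R).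

Lemma cvg_of_approx (T : Type) (FF : set_system T) (X : T -> R) : ProperFilter FF ->
  (forall e, 0 < e -> exists X' l, X' @ FF --> l /\
     \forall t \near FF, `|X t - X' t| <= e) -> cvg (X @ FF).
Proof.
move=> PF Xap; apply: cauchy_cvg; apply: cauchy_exP => e e0.
have e3 : 0 < e / 3 by rewrite divr_gt0.
have [X' [l [X'l XX']]] := Xap _ e3; exists l.
move: X'l => /cvgrPdist_le /(_ _ e3); apply: filterS2 XX' => t Xt X't.
change (`|l - X t| < e).
rewrite -(subrKA (X' t)); apply: le_lt_trans (ler_normD _ _) _.
by rewrite distrC in Xt; apply: le_lt_trans (lerD X't Xt) _; lra.
Qed.

Lemma cvg_dist (T : Type) (FF : set_system T) (X X' : T -> R) l l' e :
  ProperFilter FF -> X @ FF --> l -> X' @ FF --> l' ->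
  (\forall t \near FF, `|X t - X' t| <= e) -> `|l - l'| <= e.
Proof. by move=> PF Xl Xl'; apply: lim_norm_le; exact: cvgB. Qed.

Lemma eq_of_dist x y (C : R) : 0 <= C -> (forall e, 0 < e -> `|x - y| <= C * e) -> x = y.
Proof.
move=> C0 xy; apply/eqP; rewrite -subr_eq0 -normr_le0; apply/ler_addgt0Pr => e e0.
rewrite add0r; apply: le_trans (xy (e / (C + 1)) _) _.
  by rewrite divr_gt0 // ltr_wpDl.
by rewrite mulrA ler_pdivrMr ?ltr_wpDl // mulrC ler_pM2l // lerDl.
Qed.

Lemma lam_restr_partition a b lam m u v : Lambda a b lam -> u < v ->
  itv_partition u v (lam_restr lam m u v).
Proof.
move=> [Lp _ _] uv; split; last by rewrite last_rcons.
rewrite rcons_path path_min_sorted; last first.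
  by apply/allP => x; rewrite mem_filter => /andP[/andP[]].
rewrite lt_sorted_filter; last by case: (Lp m) => /path_sorted.
have := mem_last u [seq x <- lam m | u < x < v].
by rewrite inE mem_filter => /predU1P[->//|/andP[/andP[]]].
Qed.

Lemma lval_norm_le a b G d t e : regulated a b G -> (forall x, a <= x <= b -> `|G x| <= e) ->
  a < t <= b -> `|lval d G t| <= e.
Proof.
move=> Gr Ge /andP[at_ tb]; rewrite /lval; case: d; last by apply: Ge; rewrite ltW.
apply: (lim_norm_le _ (regulated_llim Gr (introT andP (conj at_ tb)))).
by apply/near_leftP; exists a => // x ax xt; apply: Ge; rewrite !ltW // (lt_le_trans xt).
Qed.

Lemma rval_norm_le a b G d t e : regulated a b G -> (forall x, a <= x <= b -> `|G x| <= e) ->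
  a <= t < b -> `|rval d G t| <= e.
Proof.
move=> Gr Ge /andP[at_ tb]; rewrite /rval; case: d; first by apply: Ge; rewrite at_ ltW.
apply: (lim_norm_le _ (regulated_rlim Gr (introT andP (conj at_ tb)))).
by apply/near_rightP; exists b => // x ax xt; apply: Ge; rewrite !ltW // (le_lt_trans at_).
Qed.

Lemma partial_sum_jumps_le a b d u v G h e (A : {fset R}) : regulated a b G ->
  regulated a b h -> rs_bound a b G h e -> a <= u -> u < v -> v <= b ->
  `|partial_sum (jump_term d u v G h) A| <= e *+ 2.
Proof.
move=> Gr hr Ge au uv vb; rewrite /partial_sum.
rewrite -(@big_seq_fsetE _ _ _ _ A xpredT (jump_term d u v G h)) /=.
pose s := sort <=%R [seq x <- A | u < x < v].
have ms x : x \in s -> u < x < v by rewrite mem_sort mem_filter => /andP[].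
have -> : \sum_(x <- A) jump_term d u v G h x = \sum_(x <- s) jump d G x * jump (~~ d) h x.
  rewrite (perm_big _ (permEl (perm_sort _ _))) big_filter [RHS]big_mkcond.
  apply: eq_bigr => x _; rewrite /jump_term patchE.
  case: ifPn => [/set_mem /= -> //|/negP xA].
  by rewrite ifF //; apply/negP => xuv; apply: xA; exact/mem_set.
apply: (rs_bound_jumps d (lt_le_trans (le_lt_trans au uv) vb) Gr hr Ge).
  by rewrite sort_lt_sorted filter_uniq // fset_uniq.
by move=> x /ms /andP[ux xv]; rewrite (le_lt_trans au ux) (lt_le_trans xv).
Qed.

(** All three limits that define the integral (along lambda, of the refinement
integral, of the sum over jumps) exist by the Cauchy criterion, each being
uniformly close to a convergent one. The identities between them hold for the
approximations, hence up to a multiple of e for [F]. *)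
Lemma integrable_closed d a b lam h F : a < b -> Lambda a b lam ->
  regulated a b F -> regulated a b h ->
  (forall e, 0 < e -> exists F', [/\ integrable d a b lam h F',
     forall x, a <= x <= b -> `|F x - F' x| <= e &
     rs_bound a b (fun x => F x - F' x) h e]) ->
  integrable d a b lam h F.
Proof.
move=> ab hlam Fr hr Fap; split=> //.
have subE F' : (fun x => F x - F' x) = (fun x => F x + (-1) * F' x).
  by apply/funext => x; rewrite mulN1r.
pose ts G u v m := part_sum u (lam_restr lam m u v)
  (fun x y => G (tag_pt d x y) * (h y - h x)).
have tsB e F' u v m : rs_bound a b (fun x => F x - F' x) h e ->
    a <= u -> u < v -> v <= b -> `|ts F u v m - ts F' u v m| <= e.
  rewrite subE => Ge au uv vb.
  have := rs_bound_part_sum d Ge au vb (lam_restr_partition m hlam uv).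
  by rewrite tag_sum_lin mulN1r.
pose l u v := lim (ts F u v @ \oo).
have tsl u v : a <= u -> u < v -> v <= b -> ts F u v @ \oo --> l u v.
  move=> au uv vb; apply: cvg_of_approx => e e0.
  have [F' [[_ [P [P1 _ _ _]]] _ Ge]] := Fap _ e0.
  exists (ts F' u v), (P v - P u); split; first exact: P1.
  by near=> m; exact: tsB.
have lP e F' P u v : rs_bound a b (fun x => F x - F' x) h e ->
    indef_integral d a b lam F' h P -> a <= u -> u < v -> v <= b ->
    `|l u v - (P v - P u)| <= e.
  move=> Ge [P1 _ _ _] au uv vb.
  apply: (cvg_dist _ (tsl _ _ au uv vb) (P1 _ _ au uv vb)).
  by near=> m; exact: tsB.
pose Phi t := if a < t then l a t else 0.
have PhiE u v : a <= u -> u < v -> v <= b -> Phi v - Phi u = l u v.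
  move=> au uv vb; have av := le_lt_trans au uv; rewrite /Phi av.
  move: (au); rewrite le_eqVlt => /predU1P[<-|au']; first by rewrite ltxx subr0.
  rewrite au'; apply: (@eq_of_dist _ _ 3) => // e e0.
  have [F' [[_ [P HP]] _ Ge]] := Fap _ e0.
  have ub := le_trans (ltW uv) vb.
  have := lP _ _ _ _ _ Ge HP (lexx a) av vb.
  have := lP _ _ _ _ _ Ge HP (lexx a) au' ub.
  have := lP _ _ _ _ _ Ge HP au uv vb.
  rewrite !ler_norml => /andP[? ?] /andP[? ?] /andP[? ?].
  by apply/andP; split; lra.
have PhiB e F' P u v : rs_bound a b (fun x => F x - F' x) h e ->
    indef_integral d a b lam F' h P -> a <= u -> u < v -> v <= b ->
    `|Phi v - Phi u - (P v - P u)| <= e.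
  by move=> Ge HP au uv vb; rewrite PhiE //; exact: lP HP _ _ _.
have subr F' : regulated a b F' -> regulated a b (fun x => F x - F' x).
  by rewrite subE; exact: regulated_lin.
exists Phi; split.
- move=> u v au uv vb; rewrite PhiE //; exact: tsl.
- move=> u v au uv vb; have FF := rrs_filter_proper uv.
  pose rs G (ky : seq R * seq R) :=
    RS_sum u ky.1 ky.2 (mod_at d u v G) (mod_at (~~ d) u v h).
  have rsB e F' : regulated a b F' -> rs_bound a b (fun x => F x - F' x) h e ->
      \forall ky \near rrs_filter u v, `|rs F ky - rs F' ky| <= e.
    move=> F'r Ge; exists [:: v]; split=> [|k y kuv _ tk]; first exact: itv_partition1.
    have := rs_bound_RS_sum (rs_bound_mod d (~~ d) (subr _ F'r) hr Ge au vb)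
      (lexx u) (lexx v) kuv tk.
    by rewrite subE (RS_sum_lin _ _ _ Fr F'r au vb kuv tk) mulN1r.
  have psB e F' A : regulated a b F' -> rs_bound a b (fun x => F x - F' x) h e ->
      `|partial_sum (jump_term d u v F h) A - partial_sum (jump_term d u v F' h) A| <= e *+ 2.
    move=> F'r Ge; have := partial_sum_jumps_le d A (subr _ F'r) hr Ge au uv vb.
    by rewrite subE (partial_sum_lin _ _ _ _ Fr F'r au vb) mulN1r.
  have [J HJ] : exists J, rs F @ rrs_filter u v --> (J : R).
    apply/cvg_ex; apply: cvg_of_approx => e e0.
    have [F' [[F'r [P [_ P2 _ _]]] _ Ge]] := Fap _ e0.
    have [J [S [/(is_RRSE _ _ _ uv) HJ _ _]]] := P2 _ _ au uv vb.
    by exists (rs F'), J; split=> //; exact: rsB.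
  have TF := @totally_filter R.
  have [S HS] : exists S, partial_sum (jump_term d u v F h) @ totally --> (S : R).
    apply/cvg_ex; apply: cvg_of_approx => e e0.
    have e2 : 0 < e / 2 by rewrite divr_gt0.
    have [F' [[F'r [P [_ P2 _ _]]] _ Ge]] := Fap _ e2.
    have [_ [S [_ HS _]]] := P2 _ _ au uv vb.
    exists (partial_sum (jump_term d u v F' h)), S; split=> //.
    by near=> A; apply: le_trans (psB _ _ A F'r Ge) _; rewrite mulr2n -splitr.
  exists J, S; split=> //; first exact/(is_RRSE _ _ _ uv).
  set j := jump _ h _; apply: (@eq_of_dist _ _ (4 + `|j|)) => [|e e0].
    by rewrite addr_ge0.
  have [F' [[F'r [P HP]] Gn Ge]] := Fap _ e0.
  have := PhiB _ _ _ _ _ Ge HP au uv vb; case: HP => _ P2 _ _.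
  have [J' [S' [/(is_RRSE _ _ _ uv) HJ' HS' ->]]] := P2 _ _ au uv vb.
  have JJ := cvg_dist FF HJ HJ' (rsB _ _ F'r Ge).
  have SS : `|S - S'| <= e *+ 2.
    by apply: (cvg_dist TF HS HS'); near=> A; exact: psB.
  set w := tag_pt d u v; rewrite -/j.
  have : `|F w * j - F' w * j| <= e * `|j|.
    rewrite -mulrBl normrM ler_wpM2r // Gn // /w /tag_pt.
    by case: (d); [rewrite au (le_trans (ltW uv))|rewrite vb (le_trans au (ltW uv))].
  have : (-1) ^+ (~~ d) = 1 :> R \/ (-1) ^+ (~~ d) = -1 :> R.
    by case: (~~ d); [right|left].
  move: JJ SS; rewrite mulr2n !ler_norml => /andP[? ?] /andP[? ?].
  by case=> -> /andP[? ?] /andP[? ?]; apply/andP; split; lra.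
- move=> t tab; have /andP[at_ tb] := tab; apply/cvgrPdist_le => z z0.
  set j := ljump h t.
  pose e := z / 2 / (1 + `|j|).
  have e0 : 0 < e by rewrite !divr_gt0 // ltr_wpDr.
  have [F' [[F'r [P HP]] Gn Ge]] := Fap _ e0.
  have Lj : `|lval d F t * j - lval d F' t * j| <= e * `|j|.
    rewrite -mulrBl normrM ler_wpM2r //.
    have := lval_norm_le d (subr _ F'r) Gn tab.
    by rewrite subE (lval_lin _ _ Fr F'r tab) mulN1r.
  have ez : e * `|j| + e = z / 2.
    by rewrite /e; field; rewrite gt_eqF // ltr_wpDr.
  have z2 : 0 < z / 2 by rewrite divr_gt0.
  case: (HP) => _ _ /(_ _ tab) /cvgrPdist_le /(_ _ z2) /near_leftP[c ct cP] _.
  apply/near_leftP; exists (Num.max a c); first by rewrite gt_max at_.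
  move=> x; rewrite gt_max => /andP[ax cx] xt.
  have := PhiB _ _ _ _ _ Ge HP (ltW ax) xt tb.
  have := cP _ cx xt; move: Lj; rewrite -/j !ler_norml.
  by move=> /andP[? ?] /andP[? ?] /andP[? ?]; apply/andP; split; lra.
- move=> t tab; have /andP[at_ tb] := tab; apply/cvgrPdist_le => z z0.
  set j := rjump h t.
  pose e := z / 2 / (1 + `|j|).
  have e0 : 0 < e by rewrite !divr_gt0 // ltr_wpDr.
  have [F' [[F'r [P HP]] Gn Ge]] := Fap _ e0.
  have Lj : `|rval d F t * j - rval d F' t * j| <= e * `|j|.
    rewrite -mulrBl normrM ler_wpM2r //.
    have := rval_norm_le d (subr _ F'r) Gn tab.
    by rewrite subE (rval_lin _ _ Fr F'r tab) mulN1r.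
  have ez : e * `|j| + e = z / 2.
    by rewrite /e; field; rewrite gt_eqF // ltr_wpDr.
  have z2 : 0 < z / 2 by rewrite divr_gt0.
  case: (HP) => _ _ _ /(_ _ tab) /cvgrPdist_le /(_ _ z2) /near_rightP[c ct cP].
  apply/near_rightP; exists (Num.min b c); first by rewrite lt_min tb.
  move=> x tx; rewrite lt_min => /andP[xb xc].
  have := PhiB _ _ _ _ _ Ge HP at_ tx (ltW xb).
  have := cP _ tx xc; move: Lj; rewrite -/j !ler_norml.
  by move=> /andP[? ?] /andP[? ?] /andP[? ?]; apply/andP; split; lra.
Unshelve. all: by end_near. Qed.

End stability.

(** * Sums of integrands with values 0 and 1 *)

Section tag_sums.
Context {R : realType}.
Implicit Types (a b c x y t u v e z l al J I m kap : R) (F G h H Phi : R -> R).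
Implicit Types (d s : bool) (k : seq R) (lam : nat -> seq R) (th : R -> bool).

Lemma part_sum_const u k F al h d : (forall x, x \in u :: k -> F x = al) ->
  part_sum u k (fun x y => F (tag_pt d x y) * (h y - h x)) = al * (h (last u k) - h u).
Proof.
elim: k u => [|x k IH] u Fk; first by rewrite /part_sum big_nil subrr mulr0.
rewrite part_sum_cons IH => [|z zk]; last by apply: Fk; rewrite inE zk orbT.
have -> : F (tag_pt d u x) = al.
  by apply: Fk; rewrite /tag_pt; case: (d); rewrite !inE eqxx ?orbT.
by rewrite /=; ring.
Qed.

(** The terms with left tags vanish up to the first point [x] where [th] holds and
telescope afterwards. *)
Lemma left_tag_sum u k th h : path <%R u k -> (forall x y, x <= y -> th x -> th y) ->
  ~~ th u -> th (last u k) ->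
  exists x, [/\ x \in k, th x, forall z, z \in u :: k -> th z -> x <= z &
    part_sum u k (fun x y => (th (tag_pt true x y))%:R * (h y - h x)) = h (last u k) - h x].
Proof.
move=> + thm; elim: k u => [|x k IH] u /=; first by move=> _ /negbTE ->.
move=> /andP[ux pk] thu thl; have pk' := order_path_min lt_trans pk.
rewrite part_sum_cons /tag_pt (negbTE thu) mul0r add0r.
have [thx|thx] := boolP (th x).
  exists x; split=> //; first exact: mem_head.
    move=> z; rewrite !inE => /or3P[/eqP ->|/eqP ->//|zk _]; first by rewrite (negbTE thu).
    exact/ltW/(allP pk').
  rewrite (@part_sum_const _ _ (fun x => (th x)%:R) 1 h true) ?mul1r // => z zk.
  rewrite (thm x z) //; move: zk; rewrite inE => /predU1P[->//|zk].
  exact/ltW/(allP pk').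
have [z [zk thz zmin ->]] := IH x pk thx thl.
exists z; split=> //; first by rewrite inE zk orbT.
move=> w; rewrite inE => /predU1P[->|wk]; first by rewrite (negbTE thu).
exact: zmin.
Qed.

(** With right tags the telescoping part starts at the last point where [th] fails. *)
Lemma right_tag_sum u k th h : path <%R u k -> (forall x y, x <= y -> th x -> th y) ->
  ~~ th u -> th (last u k) ->
  exists x, [/\ x \in u :: k, ~~ th x, forall z, z \in u :: k -> ~~ th z -> z <= x &
    part_sum u k (fun x y => (th (tag_pt false x y))%:R * (h y - h x)) = h (last u k) - h x].
Proof.
move=> + thm; elim: k u => [|x k IH] u /=; first by move=> _ /negbTE ->.
move=> /andP[ux pk] thu thl; have pk' := order_path_min lt_trans pk.
rewrite part_sum_cons /tag_pt.
have [thx|thx] := boolP (th x).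
  have thk z : z \in x :: k -> th z.
    rewrite inE => /predU1P[->//|zk]; apply: thm thx; exact/ltW/(allP pk').
  exists u; split=> //; first exact: mem_head.
    by move=> z; rewrite inE => /predU1P[->//|/thk ->].
  rewrite (@part_sum_const _ _ (fun x => (th x)%:R) 1 h false); first by rewrite /=; ring.
  by move=> z /thk ->.
have [z [zk thz zmax ->]] := IH x pk thx thl.
exists z; split=> //; [by rewrite inE zk orbT| |by rewrite mul0r add0r].
move=> w; rewrite inE => /predU1P[-> _|wk]; last exact: zmax.
by rewrite (le_trans (ltW ux)) // zmax // mem_head.
Qed.

Lemma RS_sum_cons u x k w (y : seq R) F H :
  RS_sum u (x :: k) (w :: y) F H = F w * (H x - H u) + RS_sum x k y F H.
Proof. by rewrite /RS_sum big_nat_recl. Qed.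

Lemma tags_cons u x k (y : seq R) : tags u (x :: k) y ->
  exists w (y' : seq R), [/\ y = w :: y', u <= w, w <= x & tags x k y'].
Proof.
case: y => [[]//|w y] [[sz] tg]; have /andP[uw wx] := tg 0%N isT.
exists w, y; split=> //; split=> // i ik; exact: (tg i.+1 ik).
Qed.

Lemma RS_sum_const u v k (y : seq R) F H al : itv_partition u v k -> tags u k y ->
  (forall x, u <= x <= v -> F x = al) -> RS_sum u k y F H = al * (H v - H u).
Proof.
elim: k u y => [|x k IH] u y kuv.
  by move=> _ _; rewrite (itv_partition_nil kuv) /RS_sum big_nil subrr mulr0.
move=> /tags_cons[w [y' [-> uw wx ty]]] Fal; have kxv := itv_partition_cons kuv.
have xv := itv_partition_le kxv.
rewrite RS_sum_cons (IH _ _ kxv ty) => [|z /andP[xz zv]].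
  by rewrite Fal ?uw ?(le_trans wx) //; ring.
by apply: Fal; rewrite zv (le_trans uw) // (le_trans wx).
Qed.

(** Among the partitions containing [c], the tag decides the value of the integrand
only on the interval that starts at [c], where [H] is almost constant as the next
point is not beyond [m]. *)
Lemma RS_sum_gt u v c m e k (y : seq R) F H : itv_partition u v k -> tags u k y ->
  (forall x, u <= x <= v -> F x = (c < x)%R%:R) ->
  u <= c -> c < m -> c \in u :: k -> m \in k ->
  (forall x, c < x <= m -> `|H x - H c| <= e) ->
  `|RS_sum u k y F H - (H v - H c)| <= e.
Proof.
elim: k u y => [//|x k IH] u y kuv /tags_cons[w [y' [-> uw wx ty]]] Fc uc cm ck mk He.
have kxv := itv_partition_cons kuv; have xv := itv_partition_le kxv.
have [/= /andP[ux pk] _] := kuv; have pk' := order_path_min lt_trans pk.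
have Fw : F w = (c < w)%R%:R by apply: Fc; rewrite uw (le_trans wx).
rewrite RS_sum_cons.
move: uc; rewrite le_eqVlt => /predU1P[uc|uc].
  have xm : x <= m.
    by move: mk; rewrite inE => /predU1P[->//|/(allP pk') /ltW].
  rewrite (RS_sum_const _ kxv ty (al := 1)) => [|z /andP[xz zv]]; last first.
    have uz := lt_le_trans ux xz.
    by rewrite Fc ?zv ?(ltW uz) // -uc uz.
  have : `|H x - H c| <= e by apply: He; rewrite -uc ux.
  have e0 : `|H x - H c| <= e -> 0 <= e by apply: le_trans.
  rewrite Fw uc mul1r; case: (c < w) => /= He'.
    by rewrite (_ : _ - _ = 0) ?normr0 ?e0 //; ring.
  by rewrite (_ : _ - _ = - (H x - H c)) ?normrN //; ring.
have xc : x <= c.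
  move: ck; rewrite !inE gt_eqF //= => /predU1P[->//|/(allP pk') /ltW //].
rewrite Fw ltNge (le_trans wx xc) mul0r add0r; apply: IH => //.
- move=> z /andP[xz zv]; apply: Fc; rewrite zv andbT.
  exact: le_trans (ltW ux) xz.
- by move: ck; rewrite inE gt_eqF.
- by move: mk; rewrite inE gt_eqF // (le_lt_trans xc).
Qed.

(** The mirror image of [RS_sum_gt]: only the interval ending at [c] matters. The
disjunction on [m] is what is preserved when the first interval is dropped. *)
Lemma RS_sum_ge u v c m e k (y : seq R) F H : itv_partition u v k -> tags u k y ->
  (forall x, u <= x <= v -> F x = (c <= x)%R%:R) ->
  c \in k -> (m \in k) || (m <= u) -> m < c ->
  (forall x, m <= x < c -> `|H c - H x| <= e) ->
  `|RS_sum u k y F H - (H v - H c)| <= e.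
Proof.
elim: k u y => [//|x k IH] u y kuv /tags_cons[w [y' [-> uw wx ty]]] Fc ck mk mc He.
have kxv := itv_partition_cons kuv; have xv := itv_partition_le kxv.
have [/= /andP[ux pk] _] := kuv; have pk' := order_path_min lt_trans pk.
have Fw : F w = (c <= w)%R%:R by apply: Fc; rewrite uw (le_trans wx).
rewrite RS_sum_cons.
have xc : x <= c.
  by move: ck; rewrite inE => /predU1P[->//|/(allP pk') /ltW].
move: xc; rewrite le_eqVlt => /predU1P[xc|xc].
  have mu : m <= u.
    case/orP: mk => //; rewrite inE => /predU1P[mx|/(allP pk') xm].
      by move: mc; rewrite mx xc ltxx.
    by move: (lt_trans xm mc); rewrite xc ltxx.
  rewrite (RS_sum_const _ kxv ty (al := 1)) => [|z /andP[xz zv]]; last first.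
    have uz := lt_le_trans ux xz.
    by rewrite Fc ?zv ?(ltW uz) // -xc xz.
  have : `|H c - H u| <= e by apply: He; rewrite mu -xc ux.
  have e0 : `|H c - H u| <= e -> 0 <= e by apply: le_trans.
  rewrite Fw xc mul1r; case: (c <= w) => /= He'.
    by rewrite (_ : _ - _ = H c - H u) //; ring.
  by rewrite (_ : _ - _ = 0) ?normr0 ?e0 //; ring.
have cw : (c <= w) = false by apply/negbTE; rewrite -ltNge (le_lt_trans wx xc).
rewrite Fw cw mul0r add0r; apply: (IH _ _ kxv ty) => //.
- move=> z /andP[xz zv]; apply: Fc; rewrite zv andbT.
  exact: le_trans (ltW ux) xz.
- by move: ck; rewrite inE gt_eqF.
- case/orP: mk => [|mu]; last by rewrite (le_trans mu (ltW ux)) orbT.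
  by rewrite inE => /predU1P[->|->//]; rewrite lexx orbT.
Qed.

Lemma is_RRS_const u v F H al : u < v -> (forall x, u <= x <= v -> F x = al) ->
  is_RRS u v F H (al * (H v - H u)).
Proof.
move=> uv Fal e e0; exists [:: v]; split=> [|k y kuv _ tk]; first exact: itv_partition1.
by rewrite (RS_sum_const _ kuv tk Fal) subrr normr0.
Qed.

Lemma is_RRS_gt u v c F H : u < v -> u <= c -> c <= v ->
  (forall x, u <= x <= v -> F x = (c < x)%R%:R) ->
  (c < v -> H x @[x --> c^'+] --> H c) -> is_RRS u v F H (H v - H c).
Proof.
move=> uv uc; rewrite le_eqVlt => /predU1P[->|cv] Fc Hc.
  rewrite subrr -(mul0r (H v - H u)); apply: is_RRS_const => // x uxv.
  by rewrite Fc //; case/andP: uxv => _; rewrite leNgt => /negbTE ->.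
move=> e e0; have e2 : 0 < e / 2 by rewrite divr_gt0.
move: Hc => /(_ cv) /cvgrPdist_le /(_ _ e2) /near_rightP[c1 cc1 Hc1].
pose m := (c + Num.min c1 v) / 2.
have cm' : c < Num.min c1 v by rewrite lt_min cc1.
have cm : c < m by rewrite /m; lra.
have : m < Num.min c1 v by rewrite /m; lra.
rewrite lt_min => /andP[mc1 mv].
exists (if u < c then [:: c; m; v] else [:: m; v]); split.
  case: ifPn => [uc'|_]; split=> //=; rewrite ?eqxx // ?uc' ?cm ?mv //.
  by rewrite (le_lt_trans uc).
move=> k y kuv k0k tk; apply: (@le_lt_trans _ _ (e / 2)); last by lra.
apply: (RS_sum_gt kuv tk Fc uc cm).
- move: uc k0k; rewrite le_eqVlt => /predU1P[->|uc]; first by rewrite mem_head.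
  by rewrite uc => k0k; rewrite inE k0k ?orbT // mem_head.
- by apply: k0k; case: ifP => _; rewrite !inE eqxx ?orbT.
- by move=> x /andP[cx xm]; rewrite distrC; apply: Hc1 => //; exact: le_lt_trans mc1.
Qed.

Lemma is_RRS_ge u v c F H : u < v -> u <= c -> c <= v ->
  (forall x, u <= x <= v -> F x = (c <= x)%R%:R) ->
  (u < c -> H x @[x --> c^'-] --> H c) -> is_RRS u v F H (H v - H c).
Proof.
move=> uv; rewrite le_eqVlt => /predU1P[<-|uc] cv Fc Hc.
  rewrite -(mul1r (H v - H u)); apply: is_RRS_const => // x uxv.
  by rewrite Fc //; case/andP: uxv => ->.
move=> e e0; have e2 : 0 < e / 2 by rewrite divr_gt0.
move: Hc => /(_ uc) /cvgrPdist_le /(_ _ e2) /near_leftP[c1 cc1 Hc1].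
pose m := (c + Num.max c1 u) / 2.
have cm' : Num.max c1 u < c by rewrite gt_max cc1.
have cm : m < c by rewrite /m; lra.
have : Num.max c1 u < m by rewrite /m; lra.
rewrite gt_max => /andP[mc1 mu].
exists (if c < v then [:: m; c; v] else [:: m; c]); split.
  case: ifPn => [cv'|vc]; split=> //=; rewrite ?eqxx // ?mu ?cm ?cv' //.
  by rewrite eq_le cv leNgt.
move=> k y kuv k0k tk; apply: (@le_lt_trans _ _ (e / 2)); last by lra.
apply: (RS_sum_ge kuv tk Fc (m := m)) => //.
- by apply: k0k; case: ifP => _; rewrite !inE eqxx ?orbT.
- by rewrite k0k //; case: ifP => _; rewrite mem_head.
- by move=> x /andP[mx xc]; apply: Hc1 => //; exact: lt_le_trans mx.
Qed.

End tag_sums.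

(** * Indefinite integrals of monotone indicators *)

Section indicators.
Context {R : realType}.
Implicit Types (a b c x y t u v e z l al J I m kap : R) (F G h H Phi : R -> R).
Implicit Types (d s : bool) (k : seq R) (lam : nat -> seq R) (th : R -> bool).

Lemma llim_const F al u t : u < t -> (forall x, u < x < t -> F x = al) ->
  F x @[x --> t^'-] --> al.
Proof.
move=> ut Fal; apply: cvg_near_cst; apply/near_leftP; exists u => // x ux xt.
by apply: Fal; rewrite ux.
Qed.

Lemma rlim_const F al v t : t < v -> (forall x, t < x < v -> F x = al) ->
  F x @[x --> t^'+] --> al.
Proof.
move=> ut Fal; apply: cvg_near_cst; apply/near_rightP; exists v => // x ux xt.
by apply: Fal; rewrite ux.
Qed.

Lemma mod_at_const d u v F al : (forall x, u <= x <= v -> F x = al) ->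
  forall x, u <= x <= v -> mod_at d u v F x = al.
Proof.
move=> Fal x /andP[ux xv]; rewrite /mod_at /left_mod /right_mod.
case: d; case: ifPn => [lt|_]; rewrite ?Fal ?ux //; apply: cvg_lim => //.
  apply: (llim_const lt) => z /andP[uz zx].
  by rewrite Fal // (ltW uz) (le_trans (ltW zx)).
apply: (rlim_const lt) => z /andP[xz zv].
by rewrite Fal // (ltW zv) (le_trans ux (ltW xz)).
Qed.

Lemma jump_const d u v F al x : (forall x, u <= x <= v -> F x = al) ->
  u < x < v -> jump d F x = 0.
Proof.
move=> Fal /andP[ux xv]; have Fx : F x = al by rewrite Fal // !ltW.
rewrite /jump /ljump /rjump Fx; case: d; apply/eqP; rewrite subr_eq0; apply/eqP.
  apply/esym/cvg_lim => //; apply: (llim_const ux) => z /andP[uz zx].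
  by rewrite Fal // (ltW uz) (ltW (lt_trans zx _)).
apply/cvg_lim => //; apply: (rlim_const xv) => z /andP[xz zv].
by rewrite Fal // (ltW zv) (ltW (lt_trans ux _)).
Qed.

Lemma is_usum_single (A : set R) (f : R -> R) c :
  (forall x, A x -> x <> c -> f x = 0) -> is_usum A f (patch (fun=> 0) A f c).
Proof.
move=> f0; rewrite /is_usum; have TF := @totally_filter R.
apply: cvg_near_cst; exists [fset c]%fset => // B /= cB.
rewrite fsub1set in cB.
rewrite /partial_sum -(@big_seq_fsetE _ _ _ _ B xpredT (patch (fun=> 0) A f)) /=.
rewrite (big_rem c) //= big1_seq ?addr0 // => x /= xB.
have xc : x <> c.
  move=> xc; move: xB; rewrite xc mem_rem_uniqF //; exact: fset_uniq.
by rewrite patchE; case: ifPn => // /set_mem xA; exact: f0.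
Qed.

Lemma mod_at_tag d u v h : u < v ->
  mod_at (~~ d) u v h v - mod_at (~~ d) u v h u
    + jump (~~ d) h (tag_pt d u v) = h v - h u.
Proof.
move=> uv; rewrite /mod_at /left_mod /right_mod /jump /ljump /rjump.
by case: d => /=; rewrite uv ltxx; ring.
Qed.

Lemma young_value_const d u v F h al : u < v ->
  (forall x, u <= x <= v -> F x = al) -> young_value d u v F h (al * (h v - h u)).
Proof.
move=> uv Fal.
exists (al * (mod_at (~~ d) u v h v - mod_at (~~ d) u v h u)), 0; split.
- by apply: is_RRS_const => //; exact: mod_at_const.
- have -> : 0 = patch (fun=> 0) [set x | u < x < v]
      (fun x => jump d F x * jump (~~ d) h x) u :> R.
    by rewrite patchE memNset //= ltxx.
  by apply: is_usum_single => x xuv _; rewrite (jump_const _ Fal xuv) mul0r.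
- rewrite -(mod_at_tag d h uv) Fal; last first.
    by rewrite /tag_pt; case: (d); rewrite lexx ltW.
  by ring.
Qed.

(** The indefinite integral is th(t) (h(t) - kap), where kap is the value or a one-sided
limit of [h] at the point where [th] switches on. On intervals where [th] does not switch
everything telescopes; the three last hypotheses describe what happens around
the switch. *)
Lemma integrable_indicator d a b lam h th kap : Lambda a b lam -> regulated a b h ->
  (forall x y, x <= y -> th x -> th y) ->
  (forall u v, a <= u -> u < v -> v <= b -> ~~ th u -> th v ->
    lam_sum_cvg lam u v (fun x y => (th (tag_pt d x y))%:R * (h y - h x)) (h v - kap) /\
    young_value d u v (fun x => (th x)%:R) h (h v - kap)) ->
  (forall t, a < t <= b -> th t -> (forall x, x < t -> ~~ th x) ->
    kap = if d then h t else llim h t) ->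
  (forall t, a <= t < b -> ~~ th t -> (forall x, t < x -> th x) ->
    kap = if d then rlim h t else h t) ->
  integrable d a b lam h (fun x => (th x)%:R).
Proof.
move=> hlam hr thm flip lflip rflip.
have left0 t : (forall x, x < t -> ~~ th x) \/ exists2 u, u < t & th u.
  have [|no] := pselect (exists2 u, u < t & th u); [by right|left=> x xt].
  by apply/negP => thx; apply: no; exists x.
have right0 t : (forall x, t < x -> th x) \/ exists2 u, t < u & ~~ th u.
  have [|no] := pselect (exists2 u, t < u & ~~ th u); [by right|left=> x xt].
  by apply/negPn/negP => thx; apply: no; exists x.
(* the one-sided limits of the indicator say whether th holds somewhere on the left,
   respectively everywhere on the right *)
have llimF t : llim (fun x => (th x)%:R) t = `[< exists2 u, u < t & th u >]%:R :> R /\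
    cvg (((th x)%:R : R) @[x --> t^'-]).
  suff : ((th x)%:R : R) @[x --> t^'-] --> (`[< exists2 u, u < t & th u >]%:R : R).
    by move=> H; split; [exact: cvg_lim|apply/cvg_ex; exists `[< exists2 u, u < t & th u >]%:R].
  case: (left0 t) => [no|[u ut thu]].
    rewrite asboolF => [|[u /no /negbTE ->]//].
    by apply: (@llim_const _ _ (t - 1)) => [|x /andP[_ /no /negbTE ->]//]; lra.
  rewrite asboolT; last by exists u.
  by apply: (llim_const ut) => x /andP[ux _]; rewrite (thm u x) // ltW.
have rlimF t : rlim (fun x => (th x)%:R) t = `[< forall x, t < x -> th x >]%:R :> R /\
    cvg (((th x)%:R : R) @[x --> t^'+]).
  suff : ((th x)%:R : R) @[x --> t^'+] --> (`[< forall x, t < x -> th x >]%:R : R).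
    by move=> H; split; [exact: cvg_lim|apply/cvg_ex; exists `[< forall x, t < x -> th x >]%:R].
  case: (right0 t) => [yes|[u ut thu]].
    rewrite asboolT //.
    by apply: (@rlim_const _ _ (t + 1)) => [|x /andP[/yes -> _]//]; lra.
  rewrite asboolF => [|yes]; last by rewrite yes in thu.
  apply: (rlim_const ut) => x /andP[_ xu]; case: (boolP (th x)) => // thx.
  by rewrite (thm x u) ?ltW in thu.
split; first by split=> t _; [case: (llimF t)|case: (rlimF t)].
exists (fun t => (th t)%:R * (h t - kap)).
have key u v : a <= u -> u < v -> v <= b ->
  [/\ ~~ th u, th v & (th v)%:R * (h v - kap) - (th u)%:R * (h u - kap) = h v - kap] \/
  exists2 al, forall x, u <= x <= v -> (th x)%:R = al &
    (th v)%:R * (h v - kap) - (th u)%:R * (h u - kap) = al * (h v - h u).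
  move=> au uv vb; case: (boolP (th u)) => [thu|thu].
    right; exists 1 => [x /andP[ux _]|]; first by rewrite (thm u x).
    by rewrite (thm u v) ?(ltW uv) //=; ring.
  case: (boolP (th v)) => [thv|thv]; [left|right].
    by split=> //=; ring.
  exists 0 => [x /andP[_ xv]|/=]; last by ring.
  by case: (boolP (th x)) => // /(thm _ _ xv); rewrite (negbTE thv).
split.
- move=> u v au uv vb; have [[thu thv ->]|[al Fal ->]] := key u v au uv vb.
    by case: (flip u v au uv vb thu thv).
  apply: cvg_near_cst; near=> m.
  have kuv := lam_restr_partition m hlam uv.
  rewrite (@part_sum_const _ _ _ (fun x => (th x)%:R) al h d).
    by case: kuv => _ /eqP ->.
  move=> x; rewrite inE => /predU1P[->|/(itv_partition_mem kuv) /andP[ux xv]].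
    by rewrite Fal // lexx ltW.
  by rewrite Fal // (ltW ux).
- move=> u v au uv vb; have [[thu thv ->]|[al Fal ->]] := key u v au uv vb.
    by case: (flip u v au uv vb thu thv).
  exact: young_value_const.
- move=> t tab; have hl := regulated_llim hr tab.
  case: (left0 t) => [no|[u ut thu]].
    have -> : (th t)%:R * (h t - kap) - lval d (fun x => (th x)%:R) t * ljump h t = 0.
      rewrite /lval /ljump (llimF t).1 asboolF => [|[u /no /negbTE ->]//].
      case: (boolP (th t)) => tht; last by case: (d) => /=; ring.
      by rewrite (lflip t tab tht no); case: (d) => /=; ring.
    apply: (@llim_const _ _ (t - 1)) => [|x /andP[_ /no /negbTE ->]]; first by lra.
    by rewrite mul0r.
  have tht : th t by apply: thm thu; exact: ltW.
  have -> : (th t)%:R * (h t - kap) - lval d (fun x => (th x)%:R) t * ljump h t = llim h t - kap.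
    rewrite /lval /ljump (llimF t).1 asboolT; last by exists u.
    by rewrite !tht; case: (d) => /=; ring.
  apply: (cvg_trans _ (cvgB hl (cvg_cst kap))); apply: near_eq_cvg.
  apply/near_leftP; exists u => // x ux xt.
  by rewrite (thm u x) ?(ltW ux) // mul1r.
- move=> t tab; have hl := regulated_rlim hr tab.
  case: (right0 t) => [yes|[u ut thu]].
    have -> : (th t)%:R * (h t - kap) + rval d (fun x => (th x)%:R) t * rjump h t = rlim h t - kap.
      rewrite /rval /rjump (rlimF t).1 asboolT //.
      case: (boolP (th t)) => tht; first by case: (d) => /=; ring.
      by rewrite (rflip t tab tht yes); case: (d) => /=; ring.
    apply: (cvg_trans _ (cvgB hl (cvg_cst kap))); apply: near_eq_cvg.
    apply/near_rightP; exists (t + 1) => [|x tx xt]; first by lra.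
    by rewrite yes // mul1r.
  have thF x : x <= u -> th x = false.
    by move=> xu; apply/negP => /(thm _ _ xu); rewrite (negbTE thu).
  have -> : (th t)%:R * (h t - kap) + rval d (fun x => (th x)%:R) t * rjump h t = 0.
    rewrite /rval /rjump (rlimF t).1 asboolF => [|yes]; last by rewrite yes in thu.
    by rewrite thF ?ltW //; case: (d) => /=; ring.
  apply: (rlim_const ut) => x /andP[_ xu].
  by rewrite thF ?ltW // mul0r.
Unshelve. all: by end_near. Qed.

Lemma integrable_const d a b lam h al : Lambda a b lam -> regulated a b h ->
  integrable d a b lam h (fun=> al).
Proof.
move=> hlam hr.
have i0 : integrable d a b lam h (fun x => (xpred0 x)%:R).
  apply: (@integrable_indicator _ _ _ _ _ xpred0 0) => // t _ _ yes.
  by have /yes : t < t + 1 by rewrite ltrDl.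
have i1 : integrable d a b lam h (fun x => (xpredT x)%:R).
  apply: (@integrable_indicator _ _ _ _ _ xpredT 0) => // t _ _ no.
  by have /no : t - 1 < t by rewrite gtrBl.
have -> : (fun=> al) = (fun x => (xpred0 x)%:R + al * (xpredT x)%:R).
  by apply/funext => x /=; rewrite mulr1 add0r.
exact: integrable_lin.
Qed.

End indicators.

(** * Indicators of half lines: the Young integral *)

Section half_lines.
Context {R : realType}.
Implicit Types (a b c x y t u v e z l al J I m kap : R) (F G h H Phi : R -> R).
Implicit Types (d s : bool) (k : seq R) (lam : nat -> seq R) (th : R -> bool).

(** Right limits are themselves continuous from the right; this gives the one-sided
continuity of the modified integrator needed in [is_RRS_gt]. *)
Lemma rlim_right_cvg h c l v : c < v -> (forall x, c < x < v -> cvg (h y @[y --> x^'+])) ->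
  h x @[x --> c^'+] --> l -> rlim h x @[x --> c^'+] --> l.
Proof.
move=> cv hr /cvgrPdist_le hl; apply/cvgrPdist_le => e e0.
have /near_rightP[c1 cc1 Hc1] := hl _ e0.
apply/near_rightP; exists (Num.min c1 v); first by rewrite lt_min cc1.
move=> x cx; rewrite lt_min => /andP[xc1 xv].
have /= hx := hr x (introT andP (conj cx xv)).
apply: (lim_norm_le _ (cvgB (cvg_cst l) hx)); apply/near_rightP; exists c1 => // y xy yc1.
exact: Hc1 (lt_trans cx xy) yc1.
Qed.

Lemma llim_left_cvg h c l u : u < c -> (forall x, u < x < c -> cvg (h y @[y --> x^'-])) ->
  h x @[x --> c^'-] --> l -> llim h x @[x --> c^'-] --> l.
Proof.
move=> cv hr /cvgrPdist_le hl; apply/cvgrPdist_le => e e0.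
have /near_leftP[c1 cc1 Hc1] := hl _ e0.
apply/near_leftP; exists (Num.max c1 u); first by rewrite gt_max cc1.
move=> x; rewrite gt_max => /andP[xc1 xv] cx.
have /= hx := hr x (introT andP (conj xv cx)).
apply: (lim_norm_le _ (cvgB (cvg_cst l) hx)); apply/near_leftP; exists c1 => // y xy yc1.
exact: Hc1 xy (lt_trans yc1 cx).
Qed.

Lemma Lambda_subset a b lam i j : Lambda a b lam -> (i <= j)%N ->
  {subset a :: lam i <= a :: lam j}.
Proof.
move=> [_ Ls _] /subnK <-; elim: (j - i)%N => [//|n IH] x /IH; exact: Ls.
Qed.

Lemma lam_union_restr a b lam c u v : Lambda a b lam -> lam_union a lam c ->
  a <= u -> u < c < v -> \forall i \near \oo, c \in lam_restr lam i u v.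
Proof.
move=> hlam [i ci] au /andP[uc cv]; exists i => // j /= ij.
have := Lambda_subset hlam ij ci; rewrite inE gt_eqF ?(le_lt_trans au) //= => cj.
by rewrite mem_rcons inE mem_filter uc cv cj orbT.
Qed.

Lemma dense_point a b lam p q u v : Lambda a b lam -> a <= u -> v <= b ->
  u <= p -> p < q -> q <= v ->
  \forall i \near \oo, exists2 x, x \in lam_restr lam i u v & p < x < q.
Proof.
move=> hlam au vb up pq qv; have [_ _ Ld] := hlam.
pose m := (p + q) / 2.
have [pm mq] : p < m /\ m < q by rewrite /m; split; lra.
have mab : a <= m <= b by apply/andP; split; lra.
have e0 : 0 < (q - p) / 2 by lra.
have [x [xl xm]] := Ld m mab _ (nbhsx_ballx m _ e0).
have {xm} : p < x < q.
  by move: xm; rewrite /ball /= /m ltr_norml => /andP[? ?]; apply/andP; split; lra.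
move=> /andP[px xq].
have uxv : u < x < v by rewrite (le_lt_trans up) //= (lt_le_trans xq).
apply: filterS (lam_union_restr hlam xl au uxv) => i xi; exists x => //; exact/andP.
Qed.

(** The half line starting at [c], with [c] included when [s] is true. Every nonconstant
monotone boolean function is of this form. *)
Definition thr s c x := if s then c <= x else c < x.

Lemma thr_mono s c x y : x <= y -> thr s c x -> thr s c y.
Proof.
by rewrite /thr; case: s => xy; [move=> /le_trans|move=> /lt_le_trans]; exact.
Qed.

Lemma thr_gt s c x : c < x -> thr s c x.
Proof. by rewrite /thr; case: s => // /ltW. Qed.

Lemma thr_lt s c x : x < c -> thr s c x = false.
Proof. by rewrite /thr; case: s => xc; apply/negbTE; rewrite -?ltNge -?leNgt // ltW. Qed.

(** Left limits turn both half lines into the open one, right limits into the closed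
one. *)
Lemma mod_at_thr d s c u v x : ~~ thr s c u -> thr s c v -> u <= x <= v ->
  mod_at d u v (fun x => (thr s c x)%:R) x = (thr (~~ d) c x)%:R :> R.
Proof.
move=> thu thv /andP[ux xv]; rewrite -[thr (~~ d) c x]/(if ~~ d then c <= x else c < x).
rewrite /mod_at /left_mod /right_mod.
case: d => /=; case: ifPn => [lt|].
- apply: cvg_lim => //; have [cx|xc] := ltP c x.
    by apply: (llim_const cx) => z /andP[cz _]; rewrite thr_gt.
  by apply: (llim_const lt) => z /andP[_ zx]; rewrite thr_lt // (lt_le_trans zx).
- rewrite -leNgt => xu; have -> : x = u by apply/le_anti; rewrite xu.
  rewrite (negbTE thu); case: (ltP c u) => // cu.
  by rewrite thr_gt in thu.
- apply: cvg_lim => //; have [cx|xc] := leP c x.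
    by apply: (rlim_const lt) => z /andP[xz _]; rewrite thr_gt // (le_lt_trans cx).
  by apply: (rlim_const xc) => z /andP[_ zc]; rewrite thr_lt.
- rewrite -leNgt => vx; have -> : x = v by apply/le_anti; rewrite xv.
  rewrite thv; case: (leP c v) => // vc.
  by rewrite thr_lt in thv.
Qed.

Lemma jump_thr_out d s c x : x <> c -> jump d (fun x => (thr s c x)%:R) x = 0 :> R.
Proof.
move=> /eqP; rewrite neq_lt => /orP[xc|cx].
  have [xm mc] : x < (x + c) / 2 /\ (x + c) / 2 < c by split; lra.
  apply: (@jump_const _ _ (x - 1) ((x + c) / 2) _ 0) => [z /andP[_ zm]|].
    by rewrite thr_lt // (le_lt_trans zm).
  by rewrite gtrBl xm ltr01.
have [xm mc] : c < (x + c) / 2 /\ (x + c) / 2 < x by split; lra.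
apply: (@jump_const _ _ ((x + c) / 2) (x + 1) _ 1) => [z /andP[mz _]|].
  by rewrite thr_gt // (lt_le_trans xm).
by rewrite ltrDl mc ltr01.
Qed.

Lemma jump_thr d s c : jump d (fun x => (thr s c x)%:R) c = (d == s)%:R :> R.
Proof.
rewrite /jump /ljump /rjump; have thc : thr s c c = s by rewrite /thr lexx ltxx; case: s.
case: d.
  have -> : llim (fun x => (thr s c x)%:R) c = 0 :> R.
    apply: cvg_lim => //; apply: (@llim_const _ _ _ (c - 1)); first by rewrite gtrBl.
    by move=> x /andP[_ xc]; rewrite thr_lt.
  by rewrite thc subr0; case: s {thc}.
have -> : rlim (fun x => (thr s c x)%:R) c = 1 :> R.
  apply: cvg_lim => //; apply: (@rlim_const _ _ _ (c + 1)); first by rewrite ltrDl.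
  by move=> x /andP[cx _]; rewrite thr_gt.
by rewrite thc; case: s {thc} => /=; rewrite ?subrr ?subr0.
Qed.

(** The limit of h(x), where x is the first partition point in the half line (left tags)
or the last one before it (right tags). This point is [c] as soon as [c] is a
partition point that belongs, respectively does not belong, to the half line;
otherwise it tends to [c] from the right, respectively from the left. *)
Definition thr_value d s h c :=
  if d then (if s then h c else rlim h c) else (if s then llim h c else h c).

Lemma thr_flip s c u v : ~~ thr s c u -> thr s c v ->
  [/\ u <= c, c <= v & if s then u < c else c < v].
Proof.
rewrite /thr; case: s; rewrite -?ltNge -?leNgt.
  by move=> uc cv; rewrite (ltW uc).
by move=> uc cv; rewrite (ltW cv).
Qed.

(** The refinement integral equals [H v - H c] for the modified integrator [H]; the sum
over jumps has at most the term at [c], and only if the indicator jumps at [c] on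
the side [d]. *)
Lemma young_value_thr d s a b h c u v : regulated a b h -> a <= u -> u < v -> v <= b ->
  ~~ thr s c u -> thr s c v ->
  young_value d u v (fun x => (thr s c x)%:R) h (h v - thr_value d s h c).
Proof.
move=> hr au uv vb thu thv; have [uc cv ucv] := thr_flip thu thv.
set H := mod_at (~~ d) u v h; set F := fun x => _.
pose f x := jump d F x * jump (~~ d) h x.
exists (H v - H c), (patch (fun=> 0) [set x | u < x < v] f c); split.
- have F1 x : u <= x <= v -> mod_at d u v F x = (thr (~~ d) c x)%:R.
    exact: mod_at_thr.
  rewrite /H; case: (d) F1 => /= F1.
    apply: is_RRS_gt => // c_v; rewrite /right_mod c_v.
    have cab : a <= c < b by rewrite (le_trans au) //= (lt_le_trans c_v).
    have hc := regulated_rlim hr cab.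
    apply: cvg_trans (rlim_right_cvg c_v _ hc).
      by apply: near_eq_cvg; apply/near_rightP; exists v => // x _ ->.
    move=> x /andP[cx xv]; case: hr => _; apply.
    by rewrite (le_trans _ (ltW cx)) ?(le_trans au) //= (lt_le_trans xv).
  apply: is_RRS_ge => // u_c; rewrite /left_mod u_c.
  have cab : a < c <= b by rewrite (le_lt_trans au) //= (le_trans cv).
  have hc := regulated_llim hr cab.
  apply: cvg_trans (llim_left_cvg u_c _ hc).
    by apply: near_eq_cvg; apply/near_leftP; exists u => // x ->.
  move=> x /andP[ux xc]; case: hr => + _; apply.
  by rewrite (le_lt_trans au) //= (le_trans (ltW xc)) // (le_trans cv).
- by apply: is_usum_single => x _ xc; rewrite jump_thr_out ?mul0r.
- rewrite /patch /f jump_thr /H /mod_at /left_mod /right_mod /thr_value /jump.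
  rewrite /ljump /rjump /F /tag_pt.
  have inA : (c \in [set x | u < x < v]) = (u < c < v).
    by apply/idP/idP => [/set_mem|cA]; [|exact/mem_set].
  rewrite inA; clear f F H inA.
  have -> : thr s c (if d then u else v) = ~~ d by case: (d); rewrite ?(negbTE thu).
  case: d; case: s ucv {thu thv} => ucv /=; rewrite ?ltxx ?ucv ?uv /=.
  + by case: (ltP c v) cv => [? _|vc cv] /=; [ring|rewrite (@le_anti _ _ c v) ?cv ?vc //; ring].
  + by case: ifP => _; ring.
  + by case: ifP => _; ring.
  + by case: (ltP u c) uc => [? _|cu uc] /=; [ring|rewrite (@le_anti _ _ c u) ?cu ?uc //; ring].
Qed.

End half_lines.

(** * Indicators of half lines: the Cauchy sums *)

Section cauchy_sums.
Context {R : realType}.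
Implicit Types (a b c x y t u v e z l al J I m kap p : R) (F G f g h H Phi : R -> R).
Implicit Types (d s : bool) (k : seq R) (lam : nat -> seq R) (th : R -> bool).

(** By density the first point of the half line tends to [c] from the right. When [c]
belongs to the half line the wanted value is h(c): either [c] is eventually a
partition point, hence that first point, or [h] has no right jump at [c]. *)
Lemma near_first_point s a b lam h c u v e : Lambda a b lam -> regulated a b h ->
  (forall x, a < x < b -> rjump h x != 0 -> lam_union a lam x) ->
  a <= u -> u < v -> v <= b -> ~~ thr s c u -> thr s c v -> 0 < e ->
  \forall i \near \oo, forall x, x \in lam_restr lam i u v -> thr s c x ->
    (forall z, z \in u :: lam_restr lam i u v -> thr s c z -> x <= z) ->
    `|thr_value true s h c - h x| <= e.
Proof.
move=> hlam hr hj au uv vb thu thv e0; have [uc cv ucv] := thr_flip thu thv.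
have vk i : v \in lam_restr lam i u v by rewrite mem_rcons mem_head.
move: (cv); rewrite le_eqVlt => /predU1P[cv'|c_v].
  case: s ucv thu thv => ucv thu thv; last by rewrite cv' ltxx in ucv.
  near=> i => x xk thx xmin; have xv : x <= v by apply: xmin thv; rewrite inE vk orbT.
  have -> : x = c by apply/le_anti/andP; split; [rewrite cv'|exact: thx].
  by rewrite subrr normr0 ltW.
have cab : a <= c < b by rewrite (le_trans au) //= (lt_le_trans c_v).
have /cvgrPdist_le /(_ _ e0) /near_rightP[c1 cc1 Hc1] := regulated_rlim hr cab.
have cm : c < Num.min c1 v by rewrite lt_min cc1.
have mv : Num.min c1 v <= v by rewrite ge_min lexx orbT.
(* c itself is seen by the partitions unless h has no jump there *)
have near_c : s -> \forall i \near \oo,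
    rlim h c = h c \/ c \in lam_restr lam i u v.
  move=> ss; rewrite ss in ucv.
  have [/eqP|jc] := boolP (rjump h c == 0).
    by move=> /subr0_eq ->; near=> i; left.
  have cU : lam_union a lam c.
    by apply: hj jc; rewrite (le_lt_trans au ucv) (lt_le_trans c_v).
  have ucv' : u < c < v by rewrite ucv.
  by apply: filterS (lam_union_restr hlam cU au ucv') => i; right.
have dp := dense_point hlam au vb uc cm mv.
case: s ucv thu thv near_c => ucv thu thv near_c.
  apply: filterS2 dp (near_c isT) => i [z zk /andP[cz]].
  rewrite lt_min => /andP[zc1 _] hc x xk cx xmin.
  have xz : x <= z by apply: xmin; [rewrite inE zk orbT|exact: ltW].
  move: cx; rewrite /thr le_eqVlt => /predU1P[<-|cx]; first by rewrite subrr normr0 ltW.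
  case: hc => [hc|ck].
    by rewrite /= -hc; apply: Hc1 => //; exact: le_lt_trans zc1.
  have : x <= c by apply: xmin; [rewrite inE ck orbT|rewrite /thr].
  by rewrite leNgt cx.
apply: filterS dp => i [z zk /andP[cz]].
rewrite lt_min => /andP[zc1 _] x xk cx xmin.
have xz : x <= z by apply: xmin => //; rewrite inE zk orbT.
by apply: Hc1 => //; exact: le_lt_trans zc1.
Unshelve. all: by end_near. Qed.

(** The mirror image of [near_first_point], for the last point before the half line. *)
Lemma near_last_point s a b lam h c u v e : Lambda a b lam -> regulated a b h ->
  (forall x, a < x < b -> ljump h x != 0 -> lam_union a lam x) ->
  a <= u -> u < v -> v <= b -> ~~ thr s c u -> thr s c v -> 0 < e ->
  \forall i \near \oo, forall x, x \in u :: lam_restr lam i u v -> ~~ thr s c x ->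
    (forall z, z \in u :: lam_restr lam i u v -> ~~ thr s c z -> z <= x) ->
    `|thr_value false s h c - h x| <= e.
Proof.
move=> hlam hr hj au uv vb thu thv e0; have [uc cv ucv] := thr_flip thu thv.
move: (uc); rewrite le_eqVlt => /predU1P[uc'|u_c].
  case: s ucv thu thv => ucv thu thv; first by rewrite uc' ltxx in ucv.
  near=> i => x xk thx xmax; have xv : u <= x by apply: xmax thu; rewrite mem_head.
  have -> : x = c.
    by apply/le_anti/andP; split; [rewrite leNgt; exact: thx|rewrite -uc'].
  by rewrite subrr normr0 ltW.
have cab : a < c <= b by rewrite (le_lt_trans au) //= (le_trans cv).
have /cvgrPdist_le /(_ _ e0) /near_leftP[c1 cc1 Hc1] := regulated_llim hr cab.
have cm : Num.max c1 u < c by rewrite gt_max cc1.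
have mv : u <= Num.max c1 u by rewrite le_max lexx orbT.
(* c itself is seen by the partitions unless h has no jump there *)
have near_c : ~~ s -> \forall i \near \oo,
    llim h c = h c \/ c \in lam_restr lam i u v.
  move=> ss; rewrite (negbTE ss) in ucv.
  have [/eqP|jc] := boolP (ljump h c == 0).
    by move=> /subr0_eq ->; near=> i; left.
  have cU : lam_union a lam c.
    by apply: hj jc; rewrite (le_lt_trans au u_c) (lt_le_trans ucv).
  have ucv' : u < c < v by rewrite u_c.
  by apply: filterS (lam_union_restr hlam cU au ucv') => i; right.
have dp := dense_point hlam au vb mv cm cv.
case: s ucv thu thv near_c => ucv thu thv near_c.
  apply: filterS dp => i [z zk /andP[+ zc]].
  rewrite gt_max => /andP[zc1 _] x xk cx xmax.
  have xz : z <= x by apply: xmax; [rewrite inE zk orbT|rewrite /thr -ltNge].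
  apply: Hc1; first exact: lt_le_trans xz.
  by rewrite ltNge.
apply: filterS2 dp (near_c isT) => i [z zk /andP[+ zc]].
rewrite gt_max => /andP[zc1 _] hc x xk cx xmax.
have xz : z <= x by apply: xmax; [rewrite inE zk orbT|rewrite /thr -leNgt ltW].
move: cx; rewrite /thr -leNgt le_eqVlt => /predU1P[->|cx]; first by rewrite subrr normr0 ltW.
case: hc => [hc|ck].
  by rewrite /= -hc; apply: Hc1 => //; exact: lt_le_trans xz.
have : c <= x by apply: xmax; [rewrite inE ck orbT|rewrite /thr ltxx].
by rewrite leNgt cx.
Unshelve. all: by end_near. Qed.

Lemma lam_sum_thr d s a b lam h c u v : Lambda a b lam -> regulated a b h ->
  (forall x, a < x < b -> jump (~~ d) h x != 0 -> lam_union a lam x) ->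
  a <= u -> u < v -> v <= b -> ~~ thr s c u -> thr s c v ->
  lam_sum_cvg lam u v (fun x y => (thr s c (tag_pt d x y))%:R * (h y - h x))
    (h v - thr_value d s h c).
Proof.
move=> hlam hr hj au uv vb thu thv; apply/cvgrPdist_le => e e0.
have kuv i := lam_restr_partition i hlam uv.
case: d hj => hj.
  apply: filterS (near_first_point hlam hr hj au uv vb thu thv e0) => i Hi.
  have [pk /eqP lk] := kuv i.
  have thl : thr s c (last u (lam_restr lam i u v)) by rewrite lk.
  have [x [xk thx xmin ->]] := left_tag_sum h pk (@thr_mono _ s c) thu thl.
  by rewrite lk opprB addrC addrA subrK -normrN opprB Hi.
apply: filterS (near_last_point hlam hr hj au uv vb thu thv e0) => i Hi.
have [pk /eqP lk] := kuv i.
have thl : thr s c (last u (lam_restr lam i u v)) by rewrite lk.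
have [x [xk thx xmax ->]] := right_tag_sum h pk (@thr_mono _ s c) thu thl.
by rewrite lk opprB addrC addrA subrK -normrN opprB Hi.
Qed.

Lemma integrable_thr d s a b lam h c : Lambda a b lam -> regulated a b h ->
  (forall x, a < x < b -> jump (~~ d) h x != 0 -> lam_union a lam x) ->
  integrable d a b lam h (fun x => (thr s c x)%:R).
Proof.
move=> hlam hr hj.
apply: (@integrable_indicator _ _ _ _ _ _ (thr s c) (thr_value d s h c)) => //.
- by move=> x y; exact: thr_mono.
- move=> u v au uv vb thu thv; split; first exact: lam_sum_thr hj _ _ _ _ _.
  exact: young_value_thr hr _ _ _ _ _.
- move=> t _ tht no.
  have ct : c = t.
    apply/eqP; rewrite eq_le; apply/andP; split; rewrite leNgt; apply/negP => lt.
      by rewrite thr_lt in tht.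
    have := no ((c + t) / 2); rewrite thr_gt; last by lra.
    by move=> H; have : ~~ true by apply: H; lra.
  by move: tht; rewrite /thr_value ct /thr; case: s {no} => //; rewrite ltxx.
- move=> t _ tht yes.
  have ct : c = t.
    apply/eqP; rewrite eq_le; apply/andP; split; rewrite leNgt; apply/negP => lt.
      have := yes ((c + t) / 2); rewrite thr_lt; last by lra.
      by move=> H; have : false by apply: H; lra.
    by rewrite thr_gt in tht.
  by move: tht; rewrite /thr_value ct /thr; case: s {yes} => //; rewrite lexx.
Qed.

(** Young's theorem together with the convergence of the Cauchy sums along lambda. *)
Lemma integrable_dualW d a b lam p F h : a < b -> Lambda a b lam -> 1 <= p ->
  dualW p a b F -> regulated a b h -> Wp p a b h ->
  (forall x, a < x < b -> jump (~~ d) h x != 0 -> lam_union a lam x) ->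
  integrable d a b lam h F.
Proof.
move=> ab hlam p1 Fp hr hp hj; apply: integrable_closed => // [|e e0].
  exact: dualW_regulated Fp.
apply: (dualW_approx ab p1 Fp hp) => //.
- by move=> al; exact: integrable_const.
- move=> G al c _ GI; apply: integrable_lin GI (integrable_thr false c hlam hr hj).
- move=> G al c _ GI; apply: integrable_lin GI (integrable_thr true c hlam hr hj).
Qed.

End cauchy_sums.

(** * Integrals with respect to a decomposable function *)

Section decompositions.
Context {R : realType}.
Implicit Types (a b c x y t u v e z l al J I m kap p : R) (F G f g h H Phi : R -> R).
Implicit Types (d s : bool) (k : seq R) (lam : nat -> seq R) (th : R -> bool).

(** For d = true (false) this is convertible to the predicate [is_LC] ([is_RC]). *)
Definition is_cauchy d a b lam F g Phi : Prop :=
  [/\ regulated a b Phi, Phi a = 0,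
    forall u v, a <= u -> u < v -> v <= b ->
      lam_sum_cvg lam u v (fun x y => F (tag_pt d x y) * (g y - g x)) (Phi v - Phi u),
    forall t, a < t <= b -> ljump Phi t = lval d F t * ljump g t &
    forall t, a <= t < b -> rjump Phi t = rval d F t * rjump g t].

Definition is_young d u v F h (I : R) : Prop :=
  (u = v /\ I = 0) \/ (u < v /\ young_value d u v F h I).

Lemma is_LYE u v F h I : is_LY u v F h I <-> is_young true u v F h I.
Proof.
split=> -[[uv I0]|[uv [J [S [HJ HS ->]]]]]; [by left|right|by left|right];
  split=> //; exists J, S; split=> //=; rewrite /jump /tag_pt /=; ring.
Qed.

Lemma is_RYE u v F h I : is_RY u v F h I <-> is_young false u v F h I.
Proof.
split=> -[[uv I0]|[uv [J [S [HJ HS ->]]]]]; [by left|right|by left|right];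
  split=> //; exists J, S; split=> //=; rewrite /jump /tag_pt /=; ring.
Qed.

Lemma young_value_unique d u v F h I I' : u < v ->
  young_value d u v F h I -> young_value d u v F h I' -> I = I'.
Proof.
move=> uv [J [S [/(is_RRSE _ _ _ uv) HJ HS ->]]] [J' [S' [/(is_RRSE _ _ _ uv) HJ' HS' ->]]].
have FF := rrs_filter_proper uv; have TF := @totally_filter R.
by rewrite (cvg_unique _ HJ HJ') ?(cvg_unique _ HS HS').
Qed.

Definition adapted d a b lam h :=
  forall x, a < x < b -> jump (~~ d) h x != 0 -> lam_union a lam x.

Definition lam_decomps d a b lam p f : set ((R -> R) * (R -> R)) :=
  [set gh | decomps a b lam p f gh /\
     adapted d a b lam gh.1 /\ adapted d a b lam gh.2].

Definition lam_value d a b lam F (gh : (R -> R) * (R -> R)) u v z : Prop :=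
  exists Phi I, [/\ is_cauchy d a b lam F gh.1 Phi, is_young d u v F gh.2 I &
    z = Phi v - Phi u + I].

Lemma tag_sum_integratorD u k F g h f C d v : itv_partition u v k ->
  (forall x, u <= x <= v -> f x = C + g x + h x) ->
  part_sum u k (fun x y => F (tag_pt d x y) * (g y - g x)) +
  part_sum u k (fun x y => F (tag_pt d x y) * (h y - h x)) =
  part_sum u k (fun x y => F (tag_pt d x y) * (f y - f x)).
Proof.
move=> kuv fE; have [_ kb] := sampling_nth kuv.
rewrite /part_sum !big_mkord -big_split; apply: eq_bigr => i _ /=.
have i0 : (i < size (u :: k))%N := ltnW (ltn_ord i).
have i1 : (i.+1 < size (u :: k))%N := ltn_ord i.
rewrite !(set_nth_default v 0) //.
by rewrite (fE (nth v (u :: k) i)) // (fE (nth v (u :: k) i.+1)) //; ring.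
Qed.

Lemma lam_value_limit d a b lam p f F gh u v z : a < b -> Lambda a b lam -> 1 <= p ->
  dualW p a b F -> lam_decomps d a b lam p f gh -> a <= u -> u < v -> v <= b ->
  lam_value d a b lam F gh u v z ->
  lam_sum_cvg lam u v (fun x y => F (tag_pt d x y) * (f y - f x)) z.
Proof.
move=> ab hlam p1 Fp [[[gr hr] [_ _] hW _ [C fE]] [_ hj]] au uv vb.
move=> [Phi [I [[_ _ P3 _ _] [[uv' _]|[_ HI]] ->]]].
  by move: uv; rewrite uv' ltxx.
have [_ [Q [Q1 Q2 _ _]]] := integrable_dualW ab hlam p1 Fp hr hW hj.
rewrite (young_value_unique uv HI (Q2 _ _ au uv vb)).
apply: cvg_trans (cvgD (P3 _ _ au uv vb) (Q1 _ _ au uv vb)).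
apply: near_eq_cvg; near=> i.
apply: (tag_sum_integratorD _ _ (C := C) (lam_restr_partition i hlam uv)) => x /andP[ux xv].
by apply: fE; rewrite (le_trans au) //= (le_trans xv).
Unshelve. all: by end_near. Qed.

(** Since g' = g + h - h', an indefinite integral against g' is obtained from the one
against g by adding that of [h] and subtracting that of [h']. *)
Lemma cauchy_transfer d a b lam p f F gh gh' : a < b -> Lambda a b lam -> 1 <= p ->
  dualW p a b F -> lam_decomps d a b lam p f gh -> lam_decomps d a b lam p f gh' ->
  (exists Phi, is_cauchy d a b lam F gh.1 Phi) ->
  exists Phi, is_cauchy d a b lam F gh'.1 Phi.
Proof.
move=> ab hlam p1 Fp [[[gr hr] _ hW [g0 h0] [C fE]] [_ hj]].
move=> [[[gr' hr'] _ hW' [g0' h0'] [C' fE']] [_ hj']] [Phi [Pr P0 P3 P4 P5]].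
have [_ [Q [Q1 _ Q3 Q4]]] := integrable_dualW ab hlam p1 Fp hr hW hj.
have [_ [Q' [Q1' _ Q3' Q4']]] := integrable_dualW ab hlam p1 Fp hr' hW' hj'.
set g := gh.1 in gr g0 fE P3 P4 P5 *; set h := gh.2 in hr hW h0 fE hj Q1 Q3 Q4 *.
set g' := gh'.1 in gr' g0' fE' *; set h' := gh'.2 in hr' hW' h0' fE' hj' Q1' Q3' Q4' *.
have CC : C = C'.
  have aab : a <= a <= b by rewrite lexx ltW.
  by move: (fE a aab); rewrite fE' // g0 h0 g0' h0' !addr0.
have gE x : a <= x <= b -> g' x = 0 + (fun x => g x + h x) x + (fun x => - h' x) x.
  by move=> xab; move: (fE x xab); rewrite fE' // CC; lra.
have llimE t : a < t <= b -> llim g' t = llim g t + llim h t - llim h' t.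
  move=> tab; apply: cvg_lim => //.
  apply: cvg_trans (cvgB (cvgD (regulated_llim gr tab) (regulated_llim hr tab))
    (regulated_llim hr' tab)).
  apply: near_eq_cvg; apply/near_leftP; exists a; first by case/andP: tab.
  move=> x ax xt; rewrite gE ?add0r // (ltW ax) /=; case/andP: tab => _.
  exact/le_trans/ltW.
have rlimE t : a <= t < b -> rlim g' t = rlim g t + rlim h t - rlim h' t.
  move=> tab; apply: cvg_lim => //.
  apply: cvg_trans (cvgB (cvgD (regulated_rlim gr tab) (regulated_rlim hr tab))
    (regulated_rlim hr' tab)).
  apply: near_eq_cvg; apply/near_rightP; exists b; first by case/andP: tab.
  move=> x tx xb; rewrite gE ?add0r // (ltW xb) andbT; case/andP: tab => at_ _.
  exact: le_trans at_ (ltW tx).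
pose P' x := Phi x + (Q x - Q a) - (Q' x - Q' a).
have P'l t : a < t <= b -> P' x @[x --> t^'-] --> P' t - lval d F t * ljump g' t.
  move=> tab; have PL := regulated_llim Pr tab.
  have := P4 _ tab; rewrite /ljump => /eqP; rewrite subr_eq => /eqP Pt.
  have -> : P' t - lval d F t * ljump g' t = llim Phi t
      + (Q t - lval d F t * ljump h t - Q a) - (Q' t - lval d F t * ljump h' t - Q' a).
    rewrite /P' Pt /ljump llimE // gE; first by ring.
    by case/andP: tab => /ltW -> ->.
  exact: cvgB (cvgD PL (cvgB (Q3 _ tab) (cvg_cst (Q a))))
     (cvgB (Q3' _ tab) (cvg_cst (Q' a))).
have P'r t : a <= t < b -> P' x @[x --> t^'+] --> P' t + rval d F t * rjump g' t.
  move=> tab; have PL := regulated_rlim Pr tab.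
  have := P5 _ tab; rewrite /rjump => /eqP; rewrite subr_eq => /eqP Pt.
  have -> : P' t + rval d F t * rjump g' t = rlim Phi t
      + (Q t + rval d F t * rjump h t - Q a) - (Q' t + rval d F t * rjump h' t - Q' a).
    rewrite /P' Pt /rjump rlimE // gE; first by ring.
    by case/andP: tab => -> /ltW ->.
  exact: cvgB (cvgD PL (cvgB (Q4 _ tab) (cvg_cst (Q a))))
     (cvgB (Q4' _ tab) (cvg_cst (Q' a))).
exists P'; split.
- split=> t tab; apply/cvg_ex; first by exists (P' t - lval d F t * ljump g' t); exact: P'l.
  by exists (P' t + rval d F t * rjump g' t); exact: P'r.
- by rewrite /P' P0 !subrr addr0 subr0.
- move=> u v au uv vb.
  have -> : P' v - P' u = (Phi v - Phi u) + (Q v - Q u) - (Q' v - Q' u).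
    by rewrite /P'; ring.
  apply: cvg_trans (cvgB (cvgD (P3 _ _ au uv vb) (Q1 _ _ au uv vb)) (Q1' _ _ au uv vb)).
  apply: near_eq_cvg; near=> i.
  have kuv := lam_restr_partition i hlam uv.
  have xab x : u <= x <= v -> a <= x <= b.
    by move=> /andP[ux xv]; rewrite (le_trans au) //= (le_trans xv).
  have E := tag_sum_integratorD F d kuv (fun x uxv => fE x (xab x uxv)).
  have E' := tag_sum_integratorD F d kuv (fun x uxv => fE' x (xab x uxv)).
  by apply/eqP; rewrite subr_eq; apply/eqP; exact: etrans E (esym E').
- move=> t tab; rewrite {1}/ljump /llim (cvg_lim _ (P'l _ tab)) //; ring.
- move=> t tab; rewrite {1}/rjump /rlim (cvg_lim _ (P'r _ tab)) //; ring.
Unshelve. all: by end_near. Qed.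

Definition lam_defined d a b lam F (A : set ((R -> R) * (R -> R))) : Prop :=
  (forall gh, A gh -> (exists Phi, is_cauchy d a b lam F gh.1 Phi) /\
     forall u v, a <= u -> u <= v -> v <= b -> exists I, is_young d u v F gh.2 I) /\
  (forall u v, a <= u -> u <= v -> v <= b ->
    forall gh gh', A gh -> A gh' -> forall z z',
      lam_value d a b lam F gh u v z -> lam_value d a b lam F gh' u v z' -> z = z').

Lemma lam_defined_dualW d a b lam p f F : a < b -> Lambda a b lam -> 1 <= p ->
  dualW p a b F ->
  (exists2 gh, lam_decomps d a b lam p f gh & exists Phi, is_cauchy d a b lam F gh.1 Phi) ->
  lam_defined d a b lam F (lam_decomps d a b lam p f).
Proof.
move=> ab hlam p1 Fp [gh0 Agh0 Phi0]; split=> [gh Agh|u v au uv vb gh gh' Agh Agh' z z' Hz Hz'].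
  split; first exact: cauchy_transfer Agh0 Agh Phi0.
  move=> u v au; rewrite le_eqVlt => /predU1P[->|uv] vb; first by exists 0; left.
  have [[[_ hr] _ hW _ _] [_ hj]] := Agh.
  have [_ [Q [_ Q2 _ _]]] := integrable_dualW ab hlam p1 Fp hr hW hj.
  by exists (Q v - Q u); right; split=> //; exact: Q2.
move: uv; rewrite le_eqVlt => /predU1P[uv|uv].
  have zero w gh1 : lam_value d a b lam F gh1 u v w -> w = 0.
    move=> [P [I [_ [[_ ->]|[+ _]] ->]]]; first by rewrite uv subrr addr0.
    by rewrite uv ltxx.
  by rewrite (zero _ _ Hz) (zero _ _ Hz').
have := lam_value_limit ab hlam p1 Fp Agh au uv vb Hz.
have := lam_value_limit ab hlam p1 Fp Agh' au uv vb Hz'.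
by move=> l1 l2; exact: cvg_unique l2 l1.
Qed.

End decompositions.

Theorem proposition23 (R : realType) (a b : R) (hab : a < b)
  (lam : nat -> seq R) (hlam : Lambda a b lam)
  (p : R) (hp1 : 1 <= p) (hp2 : p < 2)
  (f : R -> R) (hf : decomposable a b lam p f)
  (F : R -> R) (hF : dualW p a b F) :
  ((exists2 gh : (R -> R) * (R -> R),
      decomps_plus a b lam p f gh & LC_defined a b lam F gh.1) ->
    Left_defined a b lam F (decomps_plus a b lam p f)) /\
  ((exists2 gh : (R -> R) * (R -> R),
      decomps_minus a b lam p f gh & RC_defined a b lam F gh.1) ->
    Right_defined a b lam F (decomps_minus a b lam p f)).
Proof.
have plusE gh : decomps_plus a b lam p f gh <-> lam_decomps true a b lam p f gh.
  split=> [[D U]|[D [U1 U2]]]; split=> //.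
    by split=> x xab jx; apply: U; [left|right].
  by move=> x [[xab jx]|[xab jx]]; [exact: U1|exact: U2].
have minusE gh : decomps_minus a b lam p f gh <-> lam_decomps false a b lam p f gh.
  split=> [[D U]|[D [U1 U2]]]; split=> //.
    by split=> x xab jx; apply: U; [left|right].
  by move=> x [[xab jx]|[xab jx]]; [exact: U1|exact: U2].
split=> [[gh /plusE Dgh Cgh]|[gh /minusE Dgh Cgh]].
  have [H1 H2] := lam_defined_dualW hab hlam hp1 hF (ex_intro2 _ _ gh Dgh Cgh).
  split=> [gh1 /plusE /H1[C1 Y1]|u v au uv vb gh1 gh2 /plusE D1 /plusE D2 z1 z2].
    split=> // u v au uv vb; have [I HI] := Y1 _ _ au uv vb.
    by exists I; exact/is_LYE.
  move=> [P1 [I1 [C1 /is_LYE Y1 E1]]] [P2 [I2 [C2 /is_LYE Y2 E2]]].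
  by apply: (H2 _ _ au uv vb _ _ D1 D2); [exists P1, I1|exists P2, I2].
have [H1 H2] := lam_defined_dualW hab hlam hp1 hF (ex_intro2 _ _ gh Dgh Cgh).
split=> [gh1 /minusE /H1[C1 Y1]|u v au uv vb gh1 gh2 /minusE D1 /minusE D2 z1 z2].
  split=> // u v au uv vb; have [I HI] := Y1 _ _ au uv vb.
  by exists I; exact/is_RYE.
move=> [P1 [I1 [C1 /is_RYE Y1 E1]]] [P2 [I2 [C2 /is_RYE Y2 E2]]].
by apply: (H2 _ _ au uv vb _ _ D1 D2); [exists P1, I1|exists P2, I2].
Qed.
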